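(* For every $p\in(0,1)$ there is a non-adaptive monotonicity tester for functions $f\colon\{0,1\}^n\to\{0,1\}$ with respect to the measure $\mu_p^{\otimes n}$ that makes $\tilde{O}(\sqrt{n}/\varepsilon^2)$ queries. That is, there is a non-adaptive randomized algorithm that, given $n$, $\varepsilon>0$ and oracle access to $f$, makes $\tilde{O}(\sqrt{n}/\varepsilon^2)$ queries, accepts with probability $1$ whenever $f$ is monotone, and rejects with probability at least $2/3$ whenever $f$ is $\varepsilon$-far from monotone with respect to $\mu_p^{\otimes n}$.
   Context: $\{0,1\}^n$ is ordered coordinatewise: $x\le y$ iff $x_i\le y_i$ for all $i$; $f$ is monotone if $x\le y$ implies $f(x)\le f(y)$. The $p$-biased measure is $\mu_p^{\otimes n}(x)=p^{|x|}(1-p)^{n-|x|}$, where $|x|$ is the Hamming weight. For a probability measure $\mu$, the distance of $f$ from monotone is $\varepsilon(f;\mu)=\min_{g \text{ monotone}}\mu(\{x: f(x)\neq g(x)\})$, and $f$ is $\varepsilon$-far from monotone if $\varepsilon(f;\mu)\ge\varepsilon$. A tester is non-adaptive if its queries do not depend on previous answers. $\tilde{O}(\cdot)$ hides factors polylogarithmic in $n$ and $1/\varepsilon$. *)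

(* Defs.v *)
From HB Require Import structures.
From mathcomp Require Import all_boot all_order all_algebra.
From mathcomp Require Import reals exp.
Set Implicit Arguments.
Unset Strict Implicit.
Unset Printing Implicit Defensive.
Import Order.TTheory GRing.Theory Num.Theory.
Local Open Scope ring_scope.

Definition cube (n : nat) := {ffun 'I_n -> bool}.

Definition cube_le (n : nat) (x y : cube n) : bool :=
  [forall i, (x i <= y i)%N].

Definition boolfun (n : nat) := {ffun cube n -> bool}.

Definition monotone (n : nat) (f : boolfun n) : bool :=
  [forall x, forall y, cube_le x y ==> (f x <= f y)%N].

Definition hamming_weight (n : nat) (x : cube n) : nat := #|[set i | x i]|.

Section Distance.
Variables (R : realType) (n : nat).

(* A measure on the (finite) cube is given by its point masses. *)
Definition biased (p : R) (x : cube n) : R :=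
  p ^+ hamming_weight x * (1 - p) ^+ (n - hamming_weight x).

Definition disagreement (mu : cube n -> R) (f g : boolfun n) : R :=
  \sum_(x | f x != g x) mu x.

(* The search starts at the constant function 0, which is monotone, so this is
   the minimum over monotone functions for every mu. *)
Definition dist_monotone (mu : cube n -> R) (f : boolfun n) : R :=
  disagreement mu f
    [arg min_(g < [ffun=> false] : boolfun n | monotone g)
       disagreement mu f g]%O.

Definition far_from_monotone (mu : cube n -> R) (eps : R) (f : boolfun n) :=
  eps <= dist_monotone mu f.

(* A randomized non-adaptive query algorithm: the random coins s determine the
   whole list of queries, hence independently of f; the verdict (true =
   accept) depends only on s and on the list of answers.  Finitely many coin
   outcomes lose no generality, since only finitely many deterministic
   non-adaptive algorithms with a given number of queries exist. *)
Record nonadaptive_algorithm := NonadaptiveAlgorithm {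
  coins : finType;
  coin_mass : coins -> R;
  coin_mass_ge0 : forall s, 0 <= coin_mass s;
  coin_mass_sum1 : \sum_s coin_mass s = 1;
  queries : coins -> seq (cube n);
  verdict : coins -> seq bool -> bool
}.

Definition accepts (T : nonadaptive_algorithm) (f : boolfun n) (s : coins T) :=
  verdict s [seq f x | x <- queries s].

Definition prob_accept (T : nonadaptive_algorithm) (f : boolfun n) : R :=
  \sum_(s : coins T | accepts f s) coin_mass s.

Definition prob_reject (T : nonadaptive_algorithm) (f : boolfun n) : R :=
  \sum_(s : coins T | ~~ accepts f s) coin_mass s.

Definition query_complexity (T : nonadaptive_algorithm) : nat :=
  \max_(s : coins T) size (queries s).

Definition monotonicity_tester (mu : cube n -> R) (eps : R)
    (T : nonadaptive_algorithm) : Prop :=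
  (forall f, monotone f -> prob_accept T f = 1) /\
  (forall f, far_from_monotone mu eps f -> 2 / 3 <= prob_reject T f).

End Distance.

(* q = O~(g), hiding factors polylogarithmic in n and 1/eps.  The shifts by 2
   keep both logarithms bounded away from 0 for all n and all eps > 0. *)
Definition soft_O (R : realType) (q g : nat -> R -> R) : Prop :=
  exists (C : R) (k : nat), forall (n : nat) (eps : R), 0 < eps ->
    q n eps <= C * g n eps * (ln (n%:R + 2) + ln (eps^-1 + 2)) ^+ k.

(* Main.v *)
(** A violated edge of [f] is an edge of the cube along which [f] drops from 1 to 0.
The heart of the proof is a robust directed Talagrand inequality: if every violated
edge is counted at one of its two ends, and [A x] is the set of edges counted at
[x], then the mean of [sqrt |A x|] is at least the distance of [f] to increasing
functions, up to a logarithm.  To prove it, sort [f] along the directions of a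
random set [S] in a fixed order.  Sorting carries the sets [A] along without
increasing the mean of the square roots, and toggling one direction [j] in [S]
changes the sorted value at a point only if [j] is counted there.  So the undirected
Talagrand inequality, applied for each point to the sorted value as a function of
[S], shows that sorting along two independent random sets gives almost the same
function; sorting along all directions is reached from sorting along nothing by
repeatedly halving the set.

For the uniform measure on [N] coordinates, orient the violated edges so that
vertices of out-degree about [d] receive only [O(d)] edges from each other, and pick
the dyadic [d] and the set [V] of such vertices that carry most of the Talagrand
sum.  If the total influence exceeds [4 sqrt N], violated edges are abundant and a
random edge is violated with probability at least [1 / sqrt N].  Otherwise a random
upward jump of rate [q] much smaller than [1 / sqrt N] rarely changes [f], so jumping
from [V] along one of its [d] violated edges lands on a point where the drop
persists.

A [p]-biased bit is, up to a negligible error, an increasing function of [O(log n)]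
fair bits.  Composing with it at most halves the distance to increasing functions:
given an increasing function of the fair bits, take its majority vote over the
fibres, which is increasing by Harris' inequality. *)

Require Import Defs.
From HB Require Import structures.
From mathcomp Require Import all_boot all_order all_algebra.
From mathcomp Require Import boolp reals sequences exp.
From mathcomp Require Import ring lra zify.
Set Implicit Arguments.
Unset Strict Implicit.
Unset Printing Implicit Defensive.
Import Order.TTheory GRing.Theory Num.Theory.
Local Open Scope ring_scope.

(** * Finite probability *)

Record pmf (R : realFieldType) (T : finType) := Pmf {
  mass :> T -> R;
  mass_ge0 : forall t, 0 <= mass t;
  mass_sum1 : \sum_t mass t = 1
}.

Definition expect (R : realFieldType) (T : finType) (mu : pmf R T) (F : T -> R) : R :=
  \sum_t mu t * F t.

Notation "\E_ ( x ~ mu ) F" := (expect mu (fun x => F))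
  (at level 34, x name, F at level 41, right associativity,
   format "\E_ ( x  ~  mu )  F") : ring_scope.

Section Expectation.
Variables (R : realFieldType) (T : finType) (mu : pmf R T).
Implicit Types (F G : T -> R) (c : R) (P : pred T).

Lemma eq_expect F G : F =1 G -> \E_(t ~ mu) F t = \E_(t ~ mu) G t.
Proof. by move=> FG; apply: eq_bigr => t _; rewrite FG. Qed.

Lemma expectD F G : \E_(t ~ mu) (F t + G t) = \E_(t ~ mu) F t + \E_(t ~ mu) G t.
Proof. by rewrite -big_split; apply: eq_bigr => t _; rewrite mulrDr. Qed.

Lemma expectZ c F : \E_(t ~ mu) (c * F t) = c * \E_(t ~ mu) F t.
Proof. by rewrite /expect mulr_sumr; apply: eq_bigr => t _; rewrite mulrCA. Qed.

Lemma expectB F G : \E_(t ~ mu) (F t - G t) = \E_(t ~ mu) F t - \E_(t ~ mu) G t.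
Proof. by rewrite -sumrB; apply: eq_bigr => t _; rewrite mulrBr. Qed.

Lemma expect_sum (J : finType) (P : pred J) (F : J -> T -> R) :
  \E_(t ~ mu) (\sum_(j | P j) F j t) = \sum_(j | P j) \E_(t ~ mu) F j t.
Proof. by rewrite exchange_big; apply: eq_bigr => t _; rewrite mulr_sumr. Qed.

Lemma expect_const c : \E_(t ~ mu) c = c.
Proof. by rewrite /expect -mulr_suml mass_sum1 mul1r. Qed.

Lemma le_expect F G : (forall t, F t <= G t) -> \E_(t ~ mu) F t <= \E_(t ~ mu) G t.
Proof. by move=> FG; apply: ler_sum => t _; rewrite ler_wpM2l ?mass_ge0. Qed.

Lemma expect_ge0 F : (forall t, 0 <= F t) -> 0 <= \E_(t ~ mu) F t.
Proof. by move=> F0; rewrite -(expect_const 0); exact: le_expect. Qed.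

Lemma ler_norm_expect F : `|\E_(t ~ mu) F t| <= \E_(t ~ mu) `|F t|.
Proof.
apply: le_trans (ler_norm_sum _ _ _) _; apply: ler_sum => t _.
by rewrite normrM ger0_norm ?mass_ge0.
Qed.

Lemma expect_bool_bounds P : 0 <= \E_(t ~ mu) (P t)%:R <= 1.
Proof.
rewrite expect_ge0 //=; apply: le_trans (_ : _ <= \E_(t ~ mu) 1) _.
  by apply: le_expect => t; rewrite lern1 leq_b1.
by rewrite expect_const.
Qed.

End Expectation.

Lemma expect_dominated (R : realFieldType) (T : finType) (mu nu : pmf R T) (c : R)
    (F : T -> R) : (forall t, mu t <= c * nu t) -> (forall t, 0 <= F t) ->
  \E_(t ~ mu) F t <= c * \E_(t ~ nu) F t.
Proof.
by move=> mu_le F0; rewrite mulr_sumr; apply: ler_sum => t _; rewrite mulrA ler_wpM2r.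
Qed.

Lemma expect_exchange (R : realFieldType) (T U : finType) (mu : pmf R T)
    (nu : pmf R U) (F : T -> U -> R) :
  \E_(t ~ mu) \E_(u ~ nu) F t u = \E_(u ~ nu) \E_(t ~ mu) F t u.
Proof.
transitivity (\sum_u \E_(t ~ mu) (nu u * F t u)); first exact: expect_sum.
by apply: eq_bigr => u _; rewrite expectZ.
Qed.

Lemma expect_bij (R : realFieldType) (T U : finType) (mu : pmf R T) (nu : pmf R U)
    (h : U -> T) (F : T -> R) :
  bijective h -> (forall u, mu (h u) = nu u) ->
  \E_(t ~ mu) F t = \E_(u ~ nu) F (h u).
Proof.
move=> bij_h mu_h; rewrite /expect (reindex h) /=; last exact: onW_bij.
by apply: eq_bigr => u _; rewrite mu_h.
Qed.

Section Uniform.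
Variables (R : realFieldType) (T : finType).
Hypothesis T_gt0 : (0 < #|T|)%N.

Lemma uniform_mass_sum1 : \sum_(t : T) #|T|%:R^-1 = 1 :> R.
Proof. by rewrite sumr_const -[_ *+ _]mulr_natl mulfV // pnatr_eq0 -lt0n. Qed.

Definition uniform : pmf R T :=
  Pmf (fun=> eqbRL (invr_ge0 _) (ler0n _ _)) uniform_mass_sum1.

Lemma expect_uniform (F : T -> R) : \E_(t ~ uniform) F t = #|T|%:R^-1 * \sum_t F t.
Proof. by rewrite mulr_sumr. Qed.

End Uniform.

Section Bernoulli.
Variables (R : realFieldType) (q : R).
Hypothesis q01 : 0 <= q <= 1.

Lemma bernoulli_mass_ge0 (b : bool) : 0 <= if b then q else 1 - q.
Proof. by case: b; move: q01; lra. Qed.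

Lemma bernoulli_mass_sum1 : \sum_(b : bool) (if b then q else 1 - q) = 1.
Proof. by rewrite big_bool /= addrC subrK. Qed.

Definition bernoulli : pmf R bool := Pmf bernoulli_mass_ge0 bernoulli_mass_sum1.

Lemma expect_bernoulli (F : bool -> R) :
  \E_(b ~ bernoulli) F b = (1 - q) * F false + q * F true.
Proof. by rewrite /expect big_bool addrC. Qed.

End Bernoulli.

Section PairProduct.
Variables (R : realFieldType) (T U : finType) (mu : pmf R T) (nu : pmf R U).

Lemma pair_mass_ge0 (tu : T * U) : 0 <= mu tu.1 * nu tu.2.
Proof. by rewrite mulr_ge0 ?mass_ge0. Qed.

Lemma pair_mass_sum1 : \sum_(tu : T * U) mu tu.1 * nu tu.2 = 1.
Proof.
rewrite -(pair_bigA _ (fun t u => mu t * nu u)) /= -(mass_sum1 mu).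
by apply: eq_bigr => t _; rewrite -mulr_sumr mass_sum1 mulr1.
Qed.

Definition pmf_pair : pmf R (T * U)%type := Pmf pair_mass_ge0 pair_mass_sum1.

Lemma expect_pair (F : T * U -> R) :
  \E_(tu ~ pmf_pair) F tu = \E_(t ~ mu) \E_(u ~ nu) F (t, u).
Proof.
rewrite /expect (eq_bigr (fun tu => mu tu.1 * nu tu.2 * F (tu.1, tu.2))) => [|[]//].
rewrite -(pair_bigA _ (fun t u => mu t * nu u * F (t, u))) /=.
by apply: eq_bigr => t _; rewrite mulr_sumr; apply: eq_bigr => u _; rewrite mulrA.
Qed.

End PairProduct.

Section SigmaProduct.
Variables (R : realFieldType) (J : finType) (T_ : J -> finType).
Variables (mu : pmf R J) (nu : forall j, pmf R (T_ j)).

Lemma sum_tagged (F : {j : J & T_ j} -> R) :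
  \sum_c F c = \sum_j \sum_(t : T_ j) F (Tagged T_ t).
Proof. by rewrite sig_big_dep; apply: eq_bigr => -[]. Qed.

Lemma sig_mass_ge0 (c : {j : J & T_ j}) : 0 <= mu (tag c) * nu (tag c) (tagged c).
Proof. by rewrite mulr_ge0 ?mass_ge0. Qed.

Lemma sig_mass_sum1 : \sum_(c : {j : J & T_ j}) mu (tag c) * nu (tag c) (tagged c) = 1.
Proof.
rewrite sum_tagged -(mass_sum1 mu); apply: eq_bigr => j _ /=.
by rewrite -mulr_sumr mass_sum1 mulr1.
Qed.

Definition pmf_sig : pmf R {j : J & T_ j} := Pmf sig_mass_ge0 sig_mass_sum1.

Lemma expect_sig (F : {j : J & T_ j} -> R) :
  \E_(c ~ pmf_sig) F c = \E_(j ~ mu) \E_(t ~ nu j) F (Tagged T_ t).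
Proof.
rewrite [LHS]sum_tagged; apply: eq_bigr => j _.
by rewrite mulr_sumr; apply: eq_bigr => t _; rewrite mulrA.
Qed.

End SigmaProduct.

Section Update.
Variables (J : finType) (C : Type).
Implicit Types (x y : {ffun J -> C}) (i j : J) (b c : C).

Definition upd x i c : {ffun J -> C} := [ffun j => if j == i then c else x j].

Lemma upd_at x i c : upd x i c i = c.
Proof. by rewrite ffunE eqxx. Qed.

Lemma upd_neq x i c j : j != i -> upd x i c j = x j.
Proof. by rewrite ffunE => /negbTE ->. Qed.

Lemma upd_id x i : upd x i (x i) = x.
Proof. by apply/ffunP => j; rewrite ffunE; case: eqP => [->|]. Qed.

Lemma upd_upd x i b c : upd (upd x i b) i c = upd x i c.
Proof. by apply/ffunP => j; rewrite !ffunE; case: eqP. Qed.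

Lemma upd_inj x y i b c : upd x i b = upd y i c -> b = c.
Proof. by move=> /ffunP /(_ i); rewrite !upd_at. Qed.

Lemma updC x i j b c : i != j -> upd (upd x i b) j c = upd (upd x j c) i b.
Proof.
move=> ij; apply/ffunP => k; rewrite !ffunE.
by have [->|//] := eqVneq k j; rewrite eq_sym (negbTE ij).
Qed.

End Update.

Section PowerProduct.
Variables (R : realFieldType) (J C : finType) (nu : pmf R C).

Lemma ffun_mass_ge0 (x : {ffun J -> C}) : 0 <= \prod_j nu (x j).
Proof. by apply: prodr_ge0 => j _; exact: mass_ge0. Qed.

Lemma ffun_mass_sum1 : \sum_(x : {ffun J -> C}) \prod_j nu (x j) = 1.
Proof. by rewrite -(bigA_distr_bigA (fun=> nu)) big1 // => j _; exact: mass_sum1. Qed.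

Definition pmf_ffun : pmf R {ffun J -> C} := Pmf ffun_mass_ge0 ffun_mass_sum1.

Lemma expect_prod (F : J -> C -> R) :
  \E_(x ~ pmf_ffun) \prod_j F j (x j) = \prod_j \E_(c ~ nu) F j c.
Proof. by rewrite bigA_distr_bigA; apply: eq_bigr => x _; rewrite -big_split. Qed.

Lemma ffun_mass_upd (x : {ffun J -> C}) i c :
  pmf_ffun (upd x i c) * nu (x i) = pmf_ffun x * nu c.
Proof.
rewrite /= (bigD1 i) //= [in RHS](bigD1 i) //= upd_at mulrAC [RHS]mulrAC.
congr (_ * _); first exact: mulrC.
by apply: eq_bigr => j ji; rewrite upd_neq.
Qed.

(* Swapping [x i] with an independent sample preserves the joint distribution. *)
Lemma expect_resample i (F : {ffun J -> C} -> R) :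
  \E_(x ~ pmf_ffun) F x = \E_(x ~ pmf_ffun) \E_(c ~ nu) F (upd x i c).
Proof.
transitivity (\E_(xc ~ pmf_pair pmf_ffun nu) F xc.1).
  by rewrite expect_pair; apply: eq_expect => x /=; rewrite expect_const.
pose swap (xc : {ffun J -> C} * C) := (upd xc.1 i xc.2, xc.1 i).
rewrite (expect_bij (h := swap) (nu := pmf_pair pmf_ffun nu)) ?expect_pair //.
  by apply: inv_bij => -[x c]; rewrite /swap /= upd_upd upd_id upd_at.
by move=> [x c]; exact: ffun_mass_upd.
Qed.

Lemma ffun_mass_le (mu : pmf R C) (a : R) (x : {ffun J -> C}) :
  (forall c, mu c <= a * nu c) -> \prod_j mu (x j) <= a ^+ #|J| * pmf_ffun x.
Proof.
move=> mu_le; rewrite -prodr_const -big_split; apply: ler_prod => j _.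
by rewrite mass_ge0 mu_le.
Qed.

End PowerProduct.
Arguments pmf_ffun {R} J {C}.

Section Currying.
Variables (R : realFieldType) (J K C : finType) (nu : pmf R C).

Definition curry_ffun (x : {ffun J * K -> C}) : {ffun J -> {ffun K -> C}} :=
  [ffun j => [ffun k => x (j, k)]].

Definition uncurry_ffun (y : {ffun J -> {ffun K -> C}}) : {ffun J * K -> C} :=
  [ffun jk => y jk.1 jk.2].

Lemma curry_ffunK : cancel curry_ffun uncurry_ffun.
Proof. by move=> x; apply/ffunP => -[j k]; rewrite !ffunE. Qed.

Lemma uncurry_ffunK : cancel uncurry_ffun curry_ffun.
Proof. by move=> y; apply/ffunP => j; apply/ffunP => k; rewrite !ffunE. Qed.

Lemma expect_curry (F : {ffun J * K -> C} -> R) :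
  \E_(x ~ pmf_ffun (J * K)%type nu) F x
  = \E_(y ~ pmf_ffun J (pmf_ffun K nu)) F (uncurry_ffun y).
Proof.
apply: expect_bij => [|y /=]; first exact: Bijective uncurry_ffunK curry_ffunK.
by rewrite pair_bigA; apply: eq_bigr => jk _; rewrite ffunE.
Qed.

End Currying.

Section FirstCoordinate.
Variables (R : realFieldType) (C : finType) (nu : pmf R C) (k : nat).

Definition ffun_cons (c : C) (x : {ffun 'I_k -> C}) : {ffun 'I_k.+1 -> C} :=
  [ffun i => oapp x c (unlift ord0 i)].

Definition ffun_behead (x : {ffun 'I_k.+1 -> C}) : {ffun 'I_k -> C} :=
  [ffun j => x (lift ord0 j)].

Lemma ffun_cons0 c x : ffun_cons c x ord0 = c.
Proof. by rewrite ffunE unlift_none. Qed.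

Lemma ffun_cons_lift c x j : ffun_cons c x (lift ord0 j) = x j.
Proof. by rewrite ffunE liftK. Qed.

Lemma ffun_consK c x : ffun_behead (ffun_cons c x) = x.
Proof. by apply/ffunP => j; rewrite ffunE ffun_cons_lift. Qed.

Lemma ffun_beheadK (x : {ffun 'I_k.+1 -> C}) : ffun_cons (x ord0) (ffun_behead x) = x.
Proof. by apply/ffunP => i; rewrite ffunE; case: unliftP => [j|] -> /=; rewrite ?ffunE. Qed.

Lemma expect_ffun_cons (F : {ffun 'I_k.+1 -> C} -> R) :
  \E_(x ~ pmf_ffun 'I_k.+1 nu) F x
  = \E_(c ~ nu) \E_(x ~ pmf_ffun 'I_k nu) F (ffun_cons c x).
Proof.
rewrite -(expect_pair nu _ (fun cx => F (ffun_cons cx.1 cx.2))).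
apply: expect_bij => [|[c x] /=].
  exists (fun x : {ffun 'I_k.+1 -> C} => (x ord0, ffun_behead x)) => [[c x]|x] /=.
    by rewrite ffun_cons0 ffun_consK.
  exact: ffun_beheadK.
rewrite big_ord_recl ffun_cons0; congr (_ * _).
by apply: eq_bigr => j _; rewrite ffun_cons_lift.
Qed.

End FirstCoordinate.

Section Splice.
Variables (R : realFieldType) (J C : finType) (nu : pmf R C).
Implicit Types (m x : {ffun J -> C}) (i : J) (s : seq J) (c : C) (F : {ffun J -> C} -> R).

Definition splice s m x : {ffun J -> C} := [ffun j => if j \in s then m j else x j].

Lemma splice_nil m x : splice [::] m x = x.
Proof. by apply/ffunP => j; rewrite ffunE. Qed.

Lemma splice_enum m x : splice (enum J) m x = m.
Proof. by apply/ffunP => j; rewrite ffunE mem_enum. Qed.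

Lemma splice_cons_upd i s m x c : i \notin s ->
  splice (i :: s) (upd m i c) x = splice s m (upd x i c).
Proof.
move=> is_; apply/ffunP => j; rewrite !ffunE inE.
by have [->|] := eqVneq j i; rewrite ?(negbTE is_).
Qed.

Lemma splice_upd i s m x c : i \notin s ->
  splice s m (upd x i c) = upd (splice s m x) i c.
Proof.
move=> is_; apply/ffunP => j; rewrite !ffunE.
by have [->|] := eqVneq j i; rewrite ?(negbTE is_).
Qed.

Definition expect_on s F x : R := \E_(m ~ pmf_ffun J nu) F (splice s m x).

Lemma expect_on_nil F x : expect_on [::] F x = F x.
Proof.
by rewrite /expect_on; under eq_expect do rewrite splice_nil; rewrite expect_const.
Qed.

Lemma expect_on_enum F x : expect_on (enum J) F x = \E_(m ~ pmf_ffun J nu) F m.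
Proof. by apply: eq_expect => m; rewrite splice_enum. Qed.

Lemma expect_on_cons i s F x : i \notin s ->
  expect_on (i :: s) F x = \E_(c ~ nu) expect_on s F (upd x i c).
Proof.
move=> is_; rewrite /expect_on (expect_resample nu i) expect_exchange.
by apply: eq_expect => c; apply: eq_expect => m; rewrite splice_cons_upd.
Qed.

End Splice.

(** * The cube *)

Definition bits (I : finType) := {ffun I -> bool}.

Section Cube.
Variable I : finType.
Implicit Types (x y : bits I) (i j : I) (f : bits I -> bool).

Definition flip x i : bits I := upd x i (~~ x i).

Lemma flip_at x i : flip x i i = ~~ x i.
Proof. exact: upd_at. Qed.

Lemma flipK i : involutive (flip^~ i).
Proof. by move=> x; rewrite /flip upd_at upd_upd negbK upd_id. Qed.

Lemma flip_upd x i b : flip (upd x i b) i = upd x i (~~ b).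
Proof. by rewrite /flip upd_at upd_upd. Qed.

Lemma upd_flip x i b : upd (flip x i) i b = upd x i b.
Proof. exact: upd_upd. Qed.

Lemma flip_neq x i : flip x i != x.
Proof. by apply/eqP => /ffunP /(_ i); rewrite flip_at; case: (x i). Qed.

Lemma flip_inj x : injective (flip x).
Proof.
move=> i j /ffunP /(_ i); rewrite flip_at.
by have [//|ij] := eqVneq i j; rewrite upd_neq //; case: (x i).
Qed.

Definition sensitive f x i : bool := f (upd x i false) != f (upd x i true).

Definition violated f x i : bool := f (upd x i false) && ~~ f (upd x i true).

Lemma violated_sensitive f x i : violated f x i -> sensitive f x i.
Proof. by rewrite /violated /sensitive; case: (f _); case: (f _). Qed.

Lemma violated_flip f x i : violated f (flip x i) i = violated f x i.
Proof. by rewrite /violated !upd_flip. Qed.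

Lemma violated_coord f x i : violated f x i -> x i = ~~ f x.
Proof.
have -> : f x = f (upd x i (x i)) by rewrite upd_id.
rewrite /violated.
by case: (x i) => /andP [h0 /negbTE h1]; rewrite ?h0 ?h1.
Qed.

Lemma violated_value_flip f x i : violated f x i -> f (flip x i) = ~~ f x.
Proof.
move=> vx; have := violated_coord vx.
rewrite -violated_flip in vx; have := violated_coord vx; rewrite flip_at.
by case: (x i); case: (f _); case: (f _).
Qed.

Definition covers (E : bits I -> I -> bool) (A : bits I -> {set I}) i :=
  forall x, E x i -> (i \in A (upd x i false)) || (i \in A (upd x i true)).

Definition bits_not x : bits I := [ffun i => ~~ x i].
Definition bits_and x y : bits I := [ffun i => x i && y i].
Definition bits_or x y : bits I := [ffun i => x i || y i].

Lemma bits_notK : involutive bits_not.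
Proof. by move=> x; apply/ffunP => i; rewrite !ffunE negbK. Qed.

Lemma bits_not_upd x i b : bits_not (upd x i b) = upd (bits_not x) i (~~ b).
Proof. by apply/ffunP => j; rewrite !ffunE; case: eqP. Qed.

Lemma bits_not_flip x i : bits_not (flip x i) = flip (bits_not x) i.
Proof. by rewrite /flip bits_not_upd ffunE. Qed.

Definition bits_le x y := forall i, x i -> y i.

Definition increasing f := forall x y, bits_le x y -> f x -> f y.

Definition increasing_along f i := forall x, ~~ violated f x i.

Lemma increasing_coordinatewise f : (forall i, increasing_along f i) -> increasing f.
Proof.
move=> nviol x y xy fx.
suff fz s : f (splice s y x) by rewrite -(splice_enum y x).
elim: s => [|i s IH]; first by rewrite splice_nil.
have -> : splice (i :: s) y x = upd (splice s y x) i (y i).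
  by apply/ffunP => j; rewrite !ffunE inE; case: eqP => [->|].
set z := splice s y x in IH *.
have zE : z i = if i \in s then y i else x i by rewrite ffunE.
have [zi|zi] := eqVneq (z i) (y i); first by rewrite -zi upd_id.
have [xi_y yi] : z i = false /\ y i.
  by move: zi (@xy i); rewrite zE; case: ifP => _; case: (x i); case: (y i) => // _ /(_ isT).
by have := nviol i z; rewrite /violated yi -{1}xi_y upd_id IH negbK.
Qed.

End Cube.
Arguments bits_not {I} x.

Section FairBits.
Variable R : realFieldType.

Lemma half_bounds : 0 <= (2^-1 : R) <= 1.
Proof. by lra. Qed.

Definition fair_bit : pmf R bool := bernoulli half_bounds.

Lemma expect_fair_bit (F : bool -> R) : \E_(b ~ fair_bit) F b = (F false + F true) / 2.
Proof. by rewrite expect_bernoulli; field. Qed.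

Variable I : finType.
Implicit Types (i : I) (F : bits I -> R).

Definition fair_bits : pmf R (bits I) := pmf_ffun I fair_bit.

Lemma fair_bits_mass x : fair_bits x = 2^-1 ^+ #|I|.
Proof.
by rewrite /= -prodr_const; apply: eq_bigr => i _; case: (x i) => //; field.
Qed.

Lemma expect_fair_bij (h : bits I -> bits I) F : bijective h ->
  \E_(x ~ fair_bits) F (h x) = \E_(x ~ fair_bits) F x.
Proof.
by move=> bij_h; apply/esym/expect_bij => // x; rewrite !fair_bits_mass.
Qed.

Lemma expect_flip i F : \E_(x ~ fair_bits) F (flip x i) = \E_(x ~ fair_bits) F x.
Proof. exact: expect_fair_bij (inv_bij (flipK i)). Qed.

Lemma expect_bits_not F : \E_(x ~ fair_bits) F (bits_not x) = \E_(x ~ fair_bits) F x.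
Proof. exact: expect_fair_bij (inv_bij (@bits_notK I)). Qed.

Lemma expect_fair_coord i F :
  \E_(x ~ fair_bits) F x
  = \E_(x ~ fair_bits) ((F (upd x i false) + F (upd x i true)) / 2).
Proof.
by rewrite [LHS](expect_resample _ i); apply: eq_expect => x; rewrite expect_fair_bit.
Qed.

Definition neg_influence (f : bits I -> bool) : R :=
  \E_(x ~ fair_bits) \sum_i (violated f x i)%:R.

End FairBits.
Arguments fair_bit {R}.
Arguments fair_bits {R I}.

(** * Talagrand's inequality *)

Lemma expect_sqrtD (R : rcfType) (T : finType) (mu : pmf R T) (u v : T -> R) :
  Num.sqrt ((\E_(t ~ mu) u t) ^+ 2 + (\E_(t ~ mu) v t) ^+ 2)
    <= \E_(t ~ mu) Num.sqrt (u t ^+ 2 + v t ^+ 2).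
Proof.
set a := \E_(t ~ mu) u t; set b := \E_(t ~ mu) v t; set D := Num.sqrt _.
have [D0|Dneq0] := eqVneq D 0; first by rewrite D0; apply: expect_ge0 => t; exact: sqrtr_ge0.
have D_gt0 : 0 < D by rewrite lt_def Dneq0 sqrtr_ge0.
rewrite -(ler_pM2l D_gt0) -expectZ.
have -> : D * D = \E_(t ~ mu) (a * u t + b * v t).
  by rewrite expectD !expectZ -/a -/b -!expr2 sqr_sqrtr // addr_ge0 ?sqr_ge0.
apply: le_expect => t; apply: le_trans (ler_norm _) _.
rewrite -sqrtr_sqr -sqrtrM ?addr_ge0 ?sqr_ge0 //; apply: ler_wsqrtr.
rewrite -subr_ge0; set gap := (X in 0 <= X).
have -> : gap = (a * v t - b * u t) ^+ 2 by rewrite /gap; ring.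
exact: sqr_ge0.
Qed.

(* The one-dimensional step: [p0] and [p1] are the means of a Boolean function on
   the two halves of a cube. *)
Lemma variance_le_sqrt (R : rcfType) (p0 p1 : R) : 0 <= p0 <= 1 -> 0 <= p1 <= 1 ->
  (p0 + p1) / 2 * (1 - (p0 + p1) / 2)
  <= Num.sqrt (((p0 * (1 - p0) + p1 * (1 - p1)) / 2) ^+ 2 + ((p1 - p0) / 2) ^+ 2).
Proof.
move=> /andP [p0_ge0 p0_le1] /andP [p1_ge0 p1_le1]; set v := _ * (1 - _).
have v_ge0 : 0 <= v by rewrite /v; nra.
rewrite -[v]ger0_norm // -sqrtr_sqr; apply: ler_wsqrtr; rewrite -subr_ge0.
set gap := (X in 0 <= X).
have -> : gap = ((p1 - p0) / 2) ^+ 2 * (1 - 2 * v + ((p1 - p0) / 2) ^+ 2).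
  by rewrite /gap /v; field.
rewrite mulr_ge0 ?sqr_ge0 // addr_ge0 ?sqr_ge0 //.
have := sqr_ge0 (p0 + p1 - 1); rewrite /v; nra.
Qed.

Lemma sqr_sqrt_nat (R : rcfType) (n : nat) : Num.sqrt (n%:R : R) ^+ 2 = n%:R.
Proof. by rewrite sqr_sqrtr ?ler0n. Qed.

Lemma sqrt_nat_ge1 (R : rcfType) (n : nat) : (0 < n)%N -> 1 <= Num.sqrt n%:R :> R.
Proof. by move=> n_gt0; rewrite -[leLHS]sqrtr1 ler_wsqrtr // ler1n. Qed.

Lemma sqrt_nat_le (R : rcfType) (n : nat) : Num.sqrt n%:R <= n%:R :> R.
Proof.
have [->|n_gt0] := posnP n; first by rewrite sqrtr0.
by rewrite -[leRHS]sqr_sqrt_nat expr2 ler_peMl ?sqrtr_ge0 ?sqrt_nat_ge1.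
Qed.

Section Talagrand.
Variables (R : rcfType) (I : finType) (G : bits I -> bool) (A : bits I -> {set I}).
Hypothesis covered : forall i, covers (sensitive G) A i.
Local Notation expect_on := (expect_on (@fair_bit R)).

Lemma expect_on_diff_le s x i : i \notin s ->
  `|expect_on s (fun y => (G y)%:R) (upd x i true)
    - expect_on s (fun y => (G y)%:R) (upd x i false)| / 2
  <= expect_on (i :: s) (fun y => (i \in A y)%:R) x.
Proof.
move=> is_; rewrite expect_on_cons // expect_fair_bit ler_wpM2r ?invr_ge0 //.
rewrite /expect_on -expectB -expectD.
apply: le_trans (ler_norm_expect _ _) _; apply: le_expect => m.
rewrite !splice_upd //; set y := splice s m x.
have := @covered i y; rewrite /sensitive.
case: (G _); case: (G _) => /= cov;
  rewrite ?subrr ?normr0 ?addr_ge0 // ?subr0 ?sub0r ?normrN1 ?normr1;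
  by have /orP [] := cov isT => ->; rewrite ?lerDl ?lerDr.
Qed.

Lemma talagrand_on s x : uniq s ->
  let p := expect_on s (fun y => (G y)%:R) x in
  p * (1 - p) <= expect_on s (fun y => Num.sqrt (count (mem (A y)) s)%:R) x.
Proof.
elim: s x => [x _|i s IH x /= /andP [is_ us]].
  by rewrite /= !expect_on_nil sqrtr0; case: (G x) => /=; rewrite ?subrr ?mulr0 ?mul0r.
rewrite expect_on_cons // expect_fair_bit.
set p0 := expect_on s _ (upd x i false); set p1 := expect_on s _ (upd x i true).
apply: le_trans (variance_le_sqrt _ _) _; [exact: expect_bool_bounds.. |].
pose u y : R := Num.sqrt (count (mem (A y)) s)%:R; pose v y : R := (i \in A y)%:R.
have -> : expect_on (i :: s) (fun y => Num.sqrt ((i \in A y) + count (mem (A y)) s)%:R) x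
    = expect_on (i :: s) (fun y => Num.sqrt (u y ^+ 2 + v y ^+ 2)) x.
  apply: eq_expect => m; rewrite sqr_sqrt_nat addrC natrD.
  by rewrite /v; case: (i \in _); rewrite ?expr1n ?expr0n.
apply: le_trans (expect_sqrtD _ _ _); apply: ler_wsqrtr.
have u_ge : (p0 * (1 - p0) + p1 * (1 - p1)) / 2 <= expect_on (i :: s) u x.
  rewrite expect_on_cons // expect_fair_bit ler_wpM2r ?invr_ge0 //.
  by apply: lerD; exact: IH.
have u_ge0 : 0 <= (p0 * (1 - p0) + p1 * (1 - p1)) / 2.
  have /andP [? ?] : 0 <= p0 <= 1 := expect_bool_bounds _ _.
  by have /andP [? ?] : 0 <= p1 <= 1 := expect_bool_bounds _ _; nra.
have v_ge : `|(p1 - p0) / 2| <= expect_on (i :: s) v x.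
  by rewrite normrM [`|_^-1|]ger0_norm ?invr_ge0 // expect_on_diff_le.
apply: lerD; first by rewrite lerXn2r ?nnegrE // (le_trans u_ge0).
rewrite -[X in X <= _]real_normK ?num_real // lerXn2r ?nnegrE //.
exact: le_trans v_ge.
Qed.

Lemma talagrand : let p := \E_(x ~ fair_bits) (G x)%:R : R in
  p * (1 - p) <= \E_(x ~ fair_bits) Num.sqrt #|A x|%:R.
Proof.
have count_card x : count (mem (A x)) (enum I) = #|A x|.
  by rewrite cardE -size_filter {2}/enum_mem enumT.
have := talagrand_on [ffun=> false] (enum_uniq I).
by rewrite /= !expect_on_enum; under [X in _ <= X -> _]eq_expect do rewrite count_card.
Qed.

End Talagrand.

(** * Sorting *)

Section Sorting.
Variable I : finType.
Implicit Types (x S : bits I) (i j : I) (s : seq I) (b : bool) (f g : bits I -> bool).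
Implicit Types (A B : bits I -> {set I}) (T U : pred I).

Definition sort_along i f x : bool :=
  if x i then f (upd x i false) || f (upd x i true)
  else f (upd x i false) && f (upd x i true).

Definition sort_all s f : bits I -> bool := foldr sort_along f s.

(* A violated edge swaps the sets at its two ends; on a constant edge the sets are
   replaced by their union and intersection, which can only decrease the sum of
   the square roots of the cardinals. *)
Definition sort_cover_along i f A x : {set I} :=
  let x0 := upd x i false in
  let x1 := upd x i true in
  match f x0, f x1 with
  | false, true => A x
  | true, false => A (flip x i)
  | false, false => if x i then A x0 :|: A x1 else A x0 :&: A x1
  | true, true => if x i then A x0 :&: A x1 else A x0 :|: A x1
  end.

Fixpoint sort_cover s f A : bits I -> {set I} :=
  if s is i :: s' then sort_cover_along i (sort_all s' f) (sort_cover s' f A) else A.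

Lemma sort_along_upd i f x b :
  sort_along i f (upd x i b)
  = if b then f (upd x i false) || f (upd x i true)
    else f (upd x i false) && f (upd x i true).
Proof. by rewrite /sort_along upd_at !upd_upd. Qed.

Lemma sort_along_increasing i f : increasing_along (sort_along i f) i.
Proof. by move=> x; rewrite /violated !sort_along_upd; case: (f _); case: (f _). Qed.

Lemma sort_along_face i j f x b : i != j ->
  sort_along i f (upd x j b) = sort_along i (fun y => f (upd y j b)) x.
Proof. by move=> ij; rewrite /sort_along upd_neq // ![upd (upd x j b) i _]updC 1?eq_sym. Qed.

Lemma sort_cover_along_face i j f A x b : i != j ->
  sort_cover_along i f A (upd x j b)
  = sort_cover_along i (fun y => f (upd y j b)) (fun y => A (upd y j b)) x.
Proof.
move=> ij; rewrite /sort_cover_along /flip upd_neq //.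
by rewrite ![upd (upd x j b) i _]updC 1?eq_sym.
Qed.

Lemma sort_along_preserves_increasing i j f :
  increasing_along f j -> increasing_along (sort_along i f) j.
Proof.
have [<- _|ij] := eqVneq i j; first exact: sort_along_increasing.
move=> incr x; rewrite /violated !sort_along_face // /sort_along.
move: (incr (upd x i false)) (incr (upd x i true)); rewrite /violated.
by case: (x i); do 4!case: (f _).
Qed.

Lemma sort_along_id i f : increasing_along f i -> sort_along i f =1 f.
Proof.
move=> incr x; have -> : f x = f (upd x i (x i)) by rewrite upd_id.
rewrite /sort_along; have := incr x; rewrite /violated.
by case: (x i); case: (f _); case: (f _).
Qed.

Lemma sort_all_increasing j s f : j \in s -> increasing_along (sort_all s f) j.
Proof.
elim: s => //= i s IH; rewrite inE => /orP [/eqP ->|js].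
  exact: sort_along_increasing.
by apply: sort_along_preserves_increasing; exact: IH.
Qed.

Lemma sort_all_id s f :
  (forall j, j \in s -> increasing_along f j) -> sort_all s f =1 f.
Proof.
elim: s => //= i s IH incr x.
have {}IH : sort_all s f =1 f by apply: IH => j js; apply: incr; rewrite inE js orbT.
by rewrite /sort_along !IH -/(sort_along i f x) sort_along_id //; apply/incr/mem_head.
Qed.

Definition covers_drop j f A g B := forall x, f x -> ~~ g x ->
  (j \in A x) || (j \in B x).

Lemma sort_along_covers_drop i j f A g B : covers_drop j f A g B ->
  covers_drop j (sort_along i f) (sort_cover_along i f A)
                (sort_along i g) (sort_cover_along i g B).
Proof.
move=> cov x; rewrite /sort_along /sort_cover_along /flip.
have -> : A x = A (upd x i (x i)) by rewrite upd_id.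
have -> : B x = B (upd x i (x i)) by rewrite upd_id.
move: (cov (upd x i false)) (cov (upd x i true)).
case: (x i) => /=; case: (f _); case: (f _); case: (g _); case: (g _) => //=;
  rewrite ?inE; do 4!case: (j \in _) => //=;
  by move=> // cov0 cov1; (have := cov0 isT isT) || (have := cov1 isT isT).
Qed.

Lemma sort_all_covers j s f A : j \notin s -> covers (violated f) A j ->
  covers (violated (sort_all s f)) (sort_cover s f A) j.
Proof.
elim: s => //= i s IH; rewrite inE negb_or => /andP [ji js] cov x /andP [].
rewrite eq_sym in ji; rewrite !sort_along_face // !sort_cover_along_face //.
apply: sort_along_covers_drop => {}x y0 y1.
by apply: IH; rewrite // /violated y0.
Qed.

Lemma sort_along_self_covers_drop j f A : covers (violated f) A j ->
  covers_drop j (sort_along j f) (sort_cover_along j f A) f A /\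
  covers_drop j f A (sort_along j f) (sort_cover_along j f A).
Proof.
move=> cov; split=> x; have := cov x.
all: have -> : f x = f (upd x j (x j)) by rewrite upd_id.
all: have -> : A x = A (upd x j (x j)) by rewrite upd_id.
all: rewrite /sort_along /sort_cover_along /flip /violated.
all: case: (x j) => /=; case: (f _); case: (f _) => //= cov_x _ _.
all: by rewrite ?cov_x // orbC cov_x.
Qed.

Lemma sort_filter_covers_drop j s f A T U : uniq s -> covers (violated f) A j ->
  (forall i, i != j -> T i = U i) -> T j = ~~ U j ->
  covers_drop j (sort_all (filter T s) f) (sort_cover (filter T s) f A)
                (sort_all (filter U s) f) (sort_cover (filter U s) f A).
Proof.
move=> us cov TU TUj; elim: s us => [_ x /= -> //|i s IH /= /andP [is_ us]].
have [eq_ij|ij] := eqVneq i j; last first.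
  rewrite TU //; case: (U i); last exact: IH.
  exact: sort_along_covers_drop (IH us).
move: is_; rewrite {}eq_ij TUj => js.
have -> : filter T s = filter U s.
  by apply: eq_in_filter => k ks; apply: TU; apply: contraNneq js => <-.
have jsU : j \notin filter U s by rewrite mem_filter (negbTE js) andbF.
have := sort_along_self_covers_drop (sort_all_covers jsU cov).
by case: (U j) => /= -[].
Qed.

(* Toggling whether direction [j] is sorted changes the value at [x] only when the
   [j]-edge through [x] is violated at the time it is sorted. *)
Lemma sort_filter_toggle j s f A S x : uniq s -> covers (violated f) A j ->
  sort_all (filter S s) f x != sort_all (filter (flip S j) s) f x ->
  (j \in sort_cover (filter S s) f A x) || (j \in sort_cover (filter (flip S j) s) f A x).
Proof.
move=> us cov.
have agree i : i != j -> S i = flip S j i by move=> ij; rewrite /flip upd_neq.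
have differ : S j = ~~ flip S j j by rewrite flip_at negbK.
case fS: (sort_all (filter S s) f x); case fSj: (sort_all _ f x) => // _.
  by apply: (sort_filter_covers_drop us cov agree differ); rewrite // fSj.
rewrite orbC; apply: sort_filter_covers_drop; rewrite ?fS ?fSj //.
  by move=> i /agree.
by rewrite flip_at.
Qed.

End Sorting.

Section Distance.
Variables (R : realFieldType) (I : finType).
Implicit Types (f g h : bits I -> bool).

Definition dist f g : R := \E_(x ~ fair_bits) (f x != g x)%:R.

Definition far_from_increasing (eps : R) f : Prop :=
  forall g, increasing g -> eps <= dist f g.

Lemma dist_le1 f g : dist f g <= 1.
Proof. by case/andP: (expect_bool_bounds (@fair_bits R I) (fun x => f x != g x)). Qed.

Lemma dist_triangle f g h : dist f h <= dist f g + dist g h.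
Proof.
rewrite /dist -expectD; apply: le_expect => x; rewrite -natrD ler_nat.
by case: (f x); case: (g x); case: (h x).
Qed.

Lemma eq_dist f f' g g' : f =1 f' -> g =1 g' -> dist f g = dist f' g'.
Proof. by move=> ff' gg'; apply: eq_expect => x; rewrite ff' gg'. Qed.

Lemma dist_sort_along i f g : dist (sort_along i f) (sort_along i g) <= dist f g.
Proof.
rewrite /dist (expect_fair_coord i) [leRHS](expect_fair_coord i); apply: le_expect => x.
rewrite ler_pM2r ?invr_gt0 // !sort_along_upd -!natrD ler_nat.
by case: (f _); case: (f _); case: (g _); case: (g _).
Qed.

Lemma dist_sort_all s f g : dist (sort_all s f) (sort_all s g) <= dist f g.
Proof. by elim: s => //= i s; exact: le_trans (dist_sort_along _ _ _). Qed.

End Distance.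

Section CoverSize.
Variables (R : rcfType) (I : finType).
Implicit Types (f : bits I -> bool) (A : bits I -> {set I}).

Definition sqrt_size A : R := \E_(x ~ fair_bits) Num.sqrt #|A x|%:R.

Lemma sqrtD_cardIU (A B : {set I}) :
  Num.sqrt #|A :&: B|%:R + Num.sqrt #|A :|: B|%:R
    <= Num.sqrt #|A|%:R + Num.sqrt #|B|%:R :> R.
Proof.
have := cardsUI A B; have := subset_leq_card (subsetIl A B).
have := subset_leq_card (subsetIr A B).
move: #|A :&: B| #|A :|: B| #|A| #|B| => m n a b mb ma nm_ab.
rewrite -ler_sqr ?nnegrE ?addr_ge0 ?sqrtr_ge0 // !sqrrD !sqr_sqrt_nat.
rewrite -!sqrtrM ?ler0n // -!natrM addrAC [leRHS]addrAC -!natrD [(m + n)%N]addnC nm_ab.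
by rewrite lerD2l ler_pMn2r // ler_wsqrtr // ler_nat; nia.
Qed.

Lemma sqrt_size_sort_cover_along i f A : sqrt_size (sort_cover_along i f A) <= sqrt_size A.
Proof.
rewrite /sqrt_size (expect_fair_coord i) [leRHS](expect_fair_coord i).
apply: le_expect => x; rewrite ler_pM2r ?invr_gt0 //.
rewrite /sort_cover_along !upd_at !upd_upd !flip_upd /=.
have := sqrtD_cardIU (A (upd x i false)) (A (upd x i true)).
by case: (f _); case: (f _) => //; lra.
Qed.

Lemma sqrt_size_sort_cover s f A : sqrt_size (sort_cover s f A) <= sqrt_size A.
Proof. by elim: s => //= i s; exact: le_trans (sqrt_size_sort_cover_along _ _ _). Qed.

End CoverSize.

(** * The directed Talagrand inequality *)

Lemma expect_bool_neq (R : realFieldType) (T : finType) (mu : pmf R T) (G : pred T) :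
  let p := \E_(t ~ mu) (G t)%:R in
  \E_(t ~ mu) \E_(u ~ mu) (G t != G u)%:R = 2 * (p * (1 - p)).
Proof.
move=> p; pose g t : R := (G t)%:R.
transitivity (\E_(t ~ mu) (p + (1 - 2 * p) * g t)); last first.
  by rewrite expectD expect_const expectZ -/p; ring.
apply: eq_expect => t.
transitivity (\E_(u ~ mu) (g t + (1 - 2 * g t) * g u)).
  by apply: eq_expect => u; rewrite /g; case: (G t); case: (G u) => /=; ring.
by rewrite expectD expect_const expectZ -/p; ring.
Qed.

Lemma expect_dist_sort (R : rcfType) (I : finType) s (f : bits I -> bool)
    (A : bits I -> {set I}) : uniq s -> (forall j, covers (violated f) A j) ->
  \E_(S ~ fair_bits) \E_(T ~ fair_bits)
    dist R (sort_all (filter (S : bits I) s) f) (sort_all (filter (T : bits I) s) f)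
  <= 2 * sqrt_size R A.
Proof.
move=> us cov; pose G x (S : bits I) := sort_all (filter S s) f x.
have -> : \E_(S ~ fair_bits) \E_(T ~ fair_bits) dist R (G^~ S) (G^~ T)
    = \E_(x ~ fair_bits) \E_(S ~ fair_bits) \E_(T ~ fair_bits) (G x S != G x T)%:R.
  by rewrite [RHS]expect_exchange; apply: eq_expect => S; rewrite /dist expect_exchange.
under eq_expect do rewrite expect_bool_neq.
rewrite expectZ ler_pM2l //.
apply: le_trans (_ : _ <= \E_(x ~ fair_bits) \E_(S ~ fair_bits)
    Num.sqrt #|sort_cover (filter (S : bits I) s) f A x|%:R) _.
  apply: le_expect => x; apply: talagrand => j S sens.
  have := @sort_filter_toggle _ j s f A (upd S j false) x us (cov j).
  by rewrite flip_upd; apply.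
rewrite expect_exchange -[leRHS](expect_const (@fair_bits R I)); apply: le_expect => S.
exact: sqrt_size_sort_cover.
Qed.

Section DirectedTalagrand.
Variables (R : rcfType) (I : finType).
Implicit Types (Q S T : bits I) (m : nat) (s : seq I).

(* The order in which directions are sorted: those outside the first set come first
   (they stand last in the list, since [sort_all] starts from the end), and each
   half is ordered recursively by the remaining sets. *)
Fixpoint split_order m : {ffun 'I_m -> bits I} -> seq I :=
  match m with
  | 0 => fun=> enum I
  | m'.+1 => fun Ss =>
      let s := split_order (ffun_behead Ss) in
      filter (Ss ord0) s ++ filter (predC (Ss ord0)) s
  end.

Lemma split_order_uniq m (Ss : {ffun 'I_m -> bits I}) : uniq (split_order Ss).
Proof.
elim: m Ss => [|m IH] Ss /=; first exact: enum_uniq.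
rewrite cat_uniq !filter_uniq //= andbT; apply/hasPn => i.
by rewrite !mem_filter /= => /andP [/negbTE ->].
Qed.

Lemma mem_split_order m (Ss : {ffun 'I_m -> bits I}) i : i \in split_order Ss.
Proof.
elim: m Ss => [|m IH] Ss /=; first by rewrite mem_enum.
by rewrite mem_cat !mem_filter /= IH !andbT orbN.
Qed.

Variables (f : bits I -> bool) (A : bits I -> {set I}).
Hypothesis cov : forall j, covers (violated f) A j.

Definition sort_within Q s : bits I -> bool := sort_all (filter Q s) f.

Lemma dist_sort_within_le_card Q s : dist R f (sort_within Q s) <= \sum_i (Q i)%:R.
Proof.
have [/existsP [i Qi]|/existsPn Q0] := boolP [exists i, Q i].
  by apply: le_trans (dist_le1 _ _ _) _; rewrite (bigD1 i) //= Qi lerDl sumr_ge0.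
rewrite /sort_within (eq_filter (a2 := pred0)) => [|i]; last exact/negbTE/Q0.
rewrite filter_pred0 /dist /=; under eq_expect do rewrite eqxx.
by rewrite expect_const sumr_ge0.
Qed.

Lemma expect_dist_complement Q s : uniq s ->
  \E_(S ~ fair_bits) dist R (sort_within (bits_and Q S) s)
                            (sort_within (bits_and Q (bits_not S)) s)
  <= 4 * sqrt_size R A.
Proof.
move=> us; pose F S := sort_within (bits_and Q S) s.
have filter_and S : filter (bits_and Q S) s = filter S (filter Q s).
  by rewrite -filter_predI; apply: eq_filter => i; rewrite /= ffunE andbC.
have independent : \E_(S ~ fair_bits) \E_(T ~ fair_bits) dist R (F S) (F T)
    <= 2 * sqrt_size R A.
  rewrite /F /sort_within; under eq_expect => S.
    by under eq_expect do rewrite !filter_and; over.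
  by apply: expect_dist_sort; rewrite ?filter_uniq.
have complemented :
    \E_(S ~ fair_bits) \E_(T ~ fair_bits) dist R (F T) (F (bits_not S))
    <= 2 * sqrt_size R A.
  rewrite (expect_bits_not (fun S => \E_(T ~ fair_bits) dist R (F T) (F S))).
  by rewrite expect_exchange.
apply: le_trans (_ : _ <= 2 * sqrt_size R A + 2 * sqrt_size R A) _; last by lra.
apply: le_trans (lerD independent complemented).
rewrite -expectD; apply: le_expect => S.
rewrite -expectD -[leLHS](expect_const (@fair_bits R I)); apply: le_expect => T.
exact: dist_triangle.
Qed.

Lemma dist_sort_within_split Q S s :
  dist R f (sort_within Q (filter S s ++ filter (predC S) s))
  <= dist R f (sort_within (bits_and Q S) s)
     + dist R (sort_within (bits_and Q S) s) (sort_within (bits_and Q (bits_not S)) s).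
Proof.
rewrite /sort_within /sort_all filter_cat foldr_cat -!/(sort_all _ _) -!filter_predI.
have -> : filter (predI Q S) s = filter (bits_and Q S) s.
  by apply: eq_filter => i; rewrite /= ffunE.
have -> : filter (predI Q (predC S)) s = filter (bits_and Q (bits_not S)) s.
  by apply: eq_filter => i; rewrite /= !ffunE.
set sS := filter _ s; set sC := filter _ s.
apply: le_trans (dist_triangle _ _ (sort_all sS f) _) _; rewrite lerD2l.
have resort : sort_all sS (sort_all sS f) =1 sort_all sS f.
  by apply: sort_all_id => j; exact: sort_all_increasing.
rewrite -(eq_dist R resort (frefl _)); exact: dist_sort_all.
Qed.

Lemma expect_card_halved Q :
  \E_(S ~ fair_bits) (\sum_i (bits_and Q S i)%:R) = (\sum_i (Q i)%:R) / 2 :> R.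
Proof.
rewrite expect_sum mulr_suml; apply: eq_bigr => i _.
rewrite (expect_fair_coord i) -[RHS](expect_const (@fair_bits R I)).
by apply: eq_expect => S; rewrite !ffunE eqxx andbF andbT add0r.
Qed.

Lemma expect_dist_sort_within m Q :
  \E_(Ss ~ pmf_ffun 'I_m fair_bits) dist R f (sort_within Q (split_order Ss))
  <= 4 * m%:R * sqrt_size R A + (\sum_i (Q i)%:R) / 2 ^+ m.
Proof.
elim: m Q => [|m IH] Q.
  rewrite mulr0 mul0r add0r expr0 divr1.
  rewrite -[leRHS](expect_const (pmf_ffun 'I_0 (@fair_bits R I))).
  by apply: le_expect => Ss; exact: dist_sort_within_le_card.
rewrite expect_ffun_cons expect_exchange.
apply: le_trans (_ : _ <= \E_(Ss ~ pmf_ffun 'I_m fair_bits) (\E_(S ~ fair_bits)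
    dist R f (sort_within (bits_and Q S) (split_order Ss)) + 4 * sqrt_size R A)) _.
  apply: le_expect => Ss.
  apply: le_trans (lerD (lexx _) (expect_dist_complement Q (split_order_uniq Ss))).
  rewrite -expectD; apply: le_expect => S /=.
  by rewrite ffun_cons0 ffun_consK; exact: dist_sort_within_split.
rewrite expectD expect_const expect_exchange.
apply: le_trans (lerD (le_expect _ (fun S => IH (bits_and Q S))) (lexx _)) _.
rewrite expectD expect_const.
under [X in _ + X + _]eq_expect do rewrite mulrC.
rewrite expectZ expect_card_halved exprS -natr1 le_eqVlt; apply/orP; left.
by apply/eqP; field; rewrite expf_neq0 // pnatr_eq0.
Qed.

Lemma directed_talagrand (eps : R) m : far_from_increasing eps f ->
  eps <= 4 * m%:R * sqrt_size R A + #|I|%:R / 2 ^+ m.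
Proof.
move=> far; have := expect_dist_sort_within m [ffun=> true].
have -> : \sum_(i : I) ([ffun=> true] i : bool)%:R = #|I|%:R :> R.
  by rewrite -sum1_card natr_sum; apply: eq_bigr => i _; rewrite ffunE.
apply: le_trans; rewrite -[leLHS](expect_const (pmf_ffun 'I_m (@fair_bits R I))).
apply: le_expect => Ss; apply/far/increasing_coordinatewise => j.
by apply: sort_all_increasing; rewrite mem_filter ffunE mem_split_order.
Qed.

End DirectedTalagrand.

(** * Orienting the violated edges *)

Section Orientation.
Variable I : finType.
Implicit Types (x y : bits I) (j : I) (B : {set I}) (f : bits I -> bool).
Implicit Types (A : {ffun bits I -> {set I}}).

Definition orientation f (A : bits I -> {set I}) : bool :=
  [forall x, forall j, ((j \in A x) + (j \in A (flip x j)) == violated f x j)%N].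

Lemma orientationP f (A : bits I -> {set I}) :
  reflect (forall x j, ((j \in A x) + (j \in A (flip x j)) = violated f x j)%N)
    (orientation f A).
Proof. by apply: (iffP 'forall_forallP) => orA x j; apply/eqP/orA. Qed.

Lemma orientation_violated f (A : bits I -> {set I}) x j :
  orientation f A -> j \in A x -> violated f x j.
Proof. by move=> /orientationP /(_ x j) + jA; rewrite jA; case: violated. Qed.

Lemma orientation_covers f (A : bits I -> {set I}) j :
  orientation f A -> covers (violated f) A j.
Proof.
move=> /orientationP orA x viol; have := orA (upd x j false) j.
rewrite flip_upd -{1}[false]/(~~ true) -flip_upd violated_flip.
rewrite /violated !upd_upd -/(violated f x j) viol.
by case: (j \in _) => //; case: (j \in _).
Qed.

Definition balanced (A : bits I -> {set I}) : Prop := forall y t,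
  (#|[set j | (j \in A (flip y j)) && (#|A (flip y j)| <= t)%N]| <= 2 * t)%N.

Definition reorient A y B : {ffun bits I -> {set I}} :=
  [ffun x => if x == y then A y :|: B
             else [set j in A x | ~~ ((j \in B) && (flip x j == y))]].

Section Reorient.
Variables (A : {ffun bits I -> {set I}}) (y : bits I) (B : {set I}).
Hypothesis B_in : forall j, j \in B -> j \in A (flip y j).

Lemma reorient_neighbour j : j \in B -> reorient A y B (flip y j) = A (flip y j) :\ j.
Proof.
move=> jB; rewrite ffunE (negbTE (flip_neq y j)).
apply/setP => k; rewrite !inE andbC; have [->|kj] := eqVneq k j.
  by rewrite jB flipK eqxx.
suff -> : (flip (flip y j) k == y) = false by rewrite andbF.
apply/eqP => /ffunP /(_ k); rewrite flip_at /flip upd_neq //.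
by case: (y k).
Qed.

Lemma reorient_elsewhere x : x != y -> x \notin flip y @: B -> reorient A y B x = A x.
Proof.
move=> xy xB; rewrite ffunE (negbTE xy); apply/setP => j; rewrite inE andbC.
have [/andP [jB /eqP fxy]|//] := boolP ((j \in B) && (flip x j == y)).
by case/negP: xB; apply/imsetP; exists j; rewrite // -fxy flipK.
Qed.

Lemma sum_sqr_card_reorient t : (forall j, j \in B -> (#|A (flip y j)| <= t)%N) ->
  (\sum_(x | x != y) #|A x| ^ 2
   <= \sum_(x | x != y) #|reorient A y B x| ^ 2 + 2 * t * #|B|)%N.
Proof.
move=> small; have cardB : (#|B| = \sum_(x in flip y @: B) 1)%N.
  by rewrite sum1_card card_imset //; exact: flip_inj.
have drop_one x : x != y ->
    (#|A x| ^ 2 <= #|reorient A y B x| ^ 2 + 2 * t * (x \in flip y @: B))%N.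
  move=> xy; have [/imsetP [j jB ->]|xB] := boolP (x \in _); last first.
    by rewrite reorient_elsewhere // muln0 addn0.
  rewrite reorient_neighbour // muln1; have := small j jB.
  by rewrite (cardsD1 j (A _)) B_in //; move: #|_ :\ _| => a; nia.
apply: leq_trans (_ : _ <= \sum_(x | x != y)
    (#|reorient A y B x| ^ 2 + 2 * t * (x \in flip y @: B)))%N _; first exact: leq_sum.
rewrite big_split /= leq_add2l -big_distrr leq_mul2l cardB.
rewrite big_mkcond [X in _ || (_ <= X)%N]big_mkcond; apply/orP; right.
by apply: leq_sum => x _; case: (x != y); case: (x \in _).
Qed.

Variable f : bits I -> bool.
Hypothesis orA : orientation f A.

Lemma reorient_orientation : orientation f (reorient A y B).
Proof.
have /orientationP orAP := orA; apply/orientationP => x j.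
have at_y : ((j \in reorient A y B y) + (j \in reorient A y B (flip y j))
             = violated f y j)%N.
  rewrite !ffunE eqxx (negbTE (flip_neq y j)) !inE flipK eqxx andbT -orAP.
  have := orAP y j; have := @B_in j.
  case: (j \in B) => [/(_ isT) ->|_]; case: (j \in A y) => //;
    by case: (j \in A _) => //; case: violated.
have [->//|xy] := eqVneq x y.
have [E|fxy] := eqVneq (flip x j) y.
  by rewrite -(flipK j x) E flipK violated_flip addnC.
rewrite !ffunE (negbTE xy) (negbTE fxy) !inE flipK (negbTE xy) (negbTE fxy).
by rewrite !andbF !andbT orAP.
Qed.

Lemma card_reorient_at : #|reorient A y B y| = (#|A y| + #|B|)%N.
Proof.
rewrite ffunE eqxx -cardsUI (_ : A y :&: B = set0) ?cards0 ?addn0 //.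
apply/setP => j; rewrite !inE; have := orientationP _ _ orA y j.
have := @B_in j; case: (j \in B); rewrite ?andbF // => /(_ isT) ->.
by case: (j \in A y) => //; case: violated.
Qed.

End Reorient.

(* Among all orientations, take one maximising the sum of the squares of the
   out-degrees: reversing all the edges that enter [y] from vertices of out-degree
   at most [t] would otherwise increase that sum. *)
Lemma balanced_orientation f : exists2 A, orientation f A & balanced A.
Proof.
pose A0 : {ffun bits I -> {set I}} := [ffun x => [set j | violated f x j && f x]].
have or0 : orientation f A0.
  apply/orientationP => x j; rewrite !ffunE !inE violated_flip.
  by have [v|//] := boolP (violated f x j); rewrite (violated_value_flip v); case: (f x).
pose potential (A : {ffun bits I -> {set I}}) := (\sum_x #|A x| ^ 2)%N.
have [A orA maxA] := @arg_maxnP _ A0 (fun A => orientation f A) potential or0.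
exists A => // y t; set B := [set j | _].
have B_in j : j \in B -> j \in A (flip y j) by rewrite inE => /andP [].
have B_small j : j \in B -> (#|A (flip y j)| <= t)%N by rewrite inE => /andP [].
have := maxA _ (reorient_orientation B_in orA).
rewrite /potential /geq /= (bigD1 y) //= [leqRHS](bigD1 y) //= (card_reorient_at B_in orA).
have := sum_sqr_card_reorient B_in B_small.
by move: (\sum_(x | _) _)%N (\sum_(x | _) _)%N #|B| #|A y| => U W b a; nia.
Qed.

End Orientation.

(** * Dyadic levels *)

Lemma exists_ge_average (R : realFieldType) (J : finType) (t : J -> R) (eta : R) :
  (0 < #|J|)%N -> eta <= \sum_j t j -> exists j, eta <= #|J|%:R * t j.
Proof.
move=> J_gt0 eta_le; have [/existsP //|/existsPn none] :=
  boolP [exists j, eta <= #|J|%:R * t j].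
have /card_gt0P [j0 _] := J_gt0.
suff : #|J|%:R * \sum_j t j < #|J|%:R * eta by rewrite ltr_pM2l ?ltr0n // ltNge eta_le.
have -> : #|J|%:R * eta = \sum_(j : J) eta by rewrite sumr_const mulr_natl.
rewrite mulr_sumr; apply: ltr_sum => [|j _].
  by apply/hasP; exists j0; rewrite ?mem_index_enum.
by rewrite ltNge none.
Qed.

Section Levels.
Variables (R : rcfType) (I : finType) (f : bits I -> bool) (A : bits I -> {set I}).

Definition level (k : nat) (b : bool) (x : bits I) : bool :=
  (f x == b) && (2 ^ k <= #|A x| < 2 ^ k.+1)%N.

Definition level_density k b : R := \E_(x ~ fair_bits) (level k b x)%:R.

Lemma level_density_bounds k b : 0 <= level_density k b <= 1.
Proof. exact: expect_bool_bounds. Qed.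

Lemma sqrt_card_le_levels l x : (#|I| < 2 ^ l)%N ->
  Num.sqrt #|A x|%:R
  <= \sum_(kb : 'I_l * bool) Num.sqrt (2 ^+ kb.1.+1) * (level kb.1 kb.2 x)%:R :> R.
Proof.
move=> I_lt; have [->|Ax] := posnP #|A x|.
  by rewrite sqrtr0 sumr_ge0 // => kb _; rewrite mulr_ge0 ?sqrtr_ge0.
have k_lt : (trunc_log 2 #|A x| < l)%N.
  rewrite -(ltn_exp2l _ _ (ltnSn 1)); apply: leq_ltn_trans I_lt.
  by rewrite (leq_trans (trunc_logP _ Ax)) // max_card.
have /= bounds := trunc_log_bounds (ltnSn 1) Ax.
rewrite (bigD1 (Ordinal k_lt, f x)) //= /level eqxx bounds mulr1 ler_wpDr //.
  by rewrite sumr_ge0 // => kb _; rewrite mulr_ge0 ?sqrtr_ge0.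
by apply: ler_wsqrtr; rewrite -natrX ler_nat ltnW //; case/andP: bounds.
Qed.

Lemma heavy_level l : (0 < l)%N -> (#|I| < 2 ^ l)%N ->
  exists k b, (k < l)%N /\
    sqrt_size R A
    <= (2 * l)%:R * (Num.sqrt (2 ^+ k.+1) * level_density k b).
Proof.
move=> l_gt0 I_lt.
pose t (kb : 'I_l * bool) : R :=
  Num.sqrt (2 ^+ kb.1.+1) * level_density kb.1 kb.2.
have card_kb : #|{: 'I_l * bool}| = (2 * l)%N.
  by rewrite card_prod card_ord card_bool mulnC.
have [||[k b]] := @exists_ge_average R ('I_l * bool)%type t (sqrt_size R A).
- by rewrite card_kb muln_gt0.
- under [leRHS]eq_bigr do rewrite /t -expectZ.
  rewrite -expect_sum; apply: le_expect => x; exact: sqrt_card_le_levels.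
- by rewrite card_kb /= => kb_heavy; exists k, b.
Qed.

End Levels.

(** * Random upward jumps *)

Lemma exprD1_le_quad (R : realFieldType) (z : R) r : -1 <= z -> r%:R * z <= 1 ->
  (1 + z) ^+ r <= 1 + r%:R * z + (r%:R * z) ^+ 2.
Proof.
move=> z_ge; elim: r => [|r IH] rz_le; first by rewrite expr0 mul0r expr0n /= !addr0.
have r_ge0 : 0 <= r%:R :> R by [].
have {}rz_le : r%:R * z <= 1.
  by have [z0|z0] := leP 0 z; move: rz_le; rewrite -natr1; nra.
rewrite exprS; apply: le_trans (ler_wpM2l _ (IH rz_le)) _; first by lra.
rewrite -natr1 -subr_ge0; set gap := (X in 0 <= X).
have -> : gap = z ^+ 2 * (r%:R * (1 - r%:R * z) + 1) by rewrite /gap; ring.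
by rewrite mulr_ge0 ?sqr_ge0 // addr_ge0 // mulr_ge0 // subr_ge0.
Qed.

Lemma exprD1_le2 (R : realFieldType) (z : R) n :
  0 <= z -> 2 * n%:R * z <= 1 -> (1 + z) ^+ n <= 2.
Proof.
move=> z0 nz; have nz0 : 0 <= n%:R * z by rewrite mulr_ge0.
by apply: le_trans (exprD1_le_quad _ _) _; nra.
Qed.

Lemma le_two_add_expr (R : realFieldType) (t : R) r : (0 < r)%N -> 0 <= t ->
  t <= 2 + 2 / 2 ^+ r * t ^+ r.
Proof.
move=> r_gt0 t0; have [t2|t2] := leP t 2.
  by rewrite ler_wpDr // mulr_ge0 ?divr_ge0 ?exprn_ge0.
apply: ler_wpDl => //; case: r r_gt0 => // r _; rewrite !exprS.
have -> : 2 / (2 * 2 ^+ r) * (t * t ^+ r) = t * (t / 2) ^+ r.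
  by rewrite expr_div_n; field; rewrite expf_neq0 // pnatr_eq0.
by rewrite ler_peMr // exprn_ege1 // ler_pdivlMr; lra.
Qed.

Section UpwardJump.
Variables (R : realFieldType) (I : finType) (q : R).
Hypothesis q01 : 0 <= q <= 1.
Implicit Types (x y m : bits I) (i j : I) (s : seq I) (h : bits I -> R).

Definition mask : pmf R (bits I) := pmf_ffun I (bernoulli q01).

Definition bits_or_on s x m : bits I := [ffun j => x j || (m j && (j \in s))].

Lemma bits_or_on_nil x m : bits_or_on [::] x m = x.
Proof. by apply/ffunP => j; rewrite ffunE andbF orbF. Qed.

Lemma bits_or_on_enum x m : bits_or_on (enum I) x m = bits_or x m.
Proof. by apply/ffunP => j; rewrite !ffunE mem_enum andbT. Qed.

Lemma bits_or_on_cons i s x m b : i \notin s ->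
  bits_or_on (i :: s) x (upd m i b)
  = if b then upd (bits_or_on s x m) i true else bits_or_on s x m.
Proof.
move=> is_; case: b; apply/ffunP => j; rewrite !ffunE inE;
  by have [->|] := eqVneq j i; rewrite //= ?orbT // (negbTE is_) andbF.
Qed.

Lemma expect_or_on_cons i s x h : i \notin s ->
  \E_(m ~ mask) h (bits_or_on (i :: s) x m)
  = \E_(m ~ mask) ((1 - q) * h (bits_or_on s x m)
                   + q * h (upd (bits_or_on s x m) i true)).
Proof.
move=> is_; rewrite [LHS](expect_resample _ i); apply: eq_expect => m.
by rewrite expect_bernoulli !bits_or_on_cons.
Qed.

(* The density of a uniform point jumped upwards in the directions of [s]. *)
Definition tilt s x : R := \prod_(i <- s) (if x i then 1 + q else 1 - q).

Lemma tilt_ge0 s x : 0 <= tilt s x.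
Proof. by apply: prodr_ge0 => i _; have /andP [? ?] := q01; case: (x i); lra. Qed.

Lemma tilt_upd s x i b : i \notin s -> tilt s (upd x i b) = tilt s x.
Proof.
move=> is_; apply: eq_big_seq => j js; rewrite upd_neq //.
by apply: contraNneq is_ => <-.
Qed.

Lemma tilt_cons_upd i s x b : i \notin s ->
  tilt (i :: s) (upd x i b) = (if b then 1 + q else 1 - q) * tilt s x.
Proof. by move=> is_; rewrite /tilt big_cons -/(tilt _ _) tilt_upd // upd_at. Qed.

Lemma expect_or_on s h : uniq s ->
  \E_(x ~ fair_bits) \E_(m ~ mask) h (bits_or_on s x m)
  = \E_(x ~ fair_bits) (tilt s x * h x).
Proof.
elim: s h => [|i s IH] h /=.
  move=> _; apply: eq_expect => x; rewrite /tilt big_nil mul1r.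
  by under eq_expect do rewrite bits_or_on_nil; rewrite expect_const.
move=> /andP [is_ us]; under eq_expect do rewrite expect_or_on_cons //.
rewrite (IH (fun y => (1 - q) * h y + q * h (upd y i true))) //.
rewrite (expect_fair_coord i) [RHS](expect_fair_coord i); apply: eq_expect => x.
by rewrite !tilt_cons_upd // !tilt_upd // !upd_upd /=; field.
Qed.

Lemma expect_tilt_exp s r : uniq s -> r%:R * q <= 1 ->
  \E_(x ~ fair_bits) tilt s x ^+ r <= (1 + (r%:R * q) ^+ 2) ^+ size s.
Proof.
have /andP [q0 q1] := q01; move=> + rq; elim: s => [_|i s IH /= /andP [is_ us]].
  by under eq_expect do rewrite /tilt big_nil expr1n; rewrite expect_const.
rewrite exprS (expect_fair_coord i).
apply: le_trans (ler_wpM2l _ (IH us)); last by rewrite addr_ge0 ?sqr_ge0.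
rewrite -expectZ; apply: le_expect => x; rewrite !tilt_cons_upd // !exprMn -mulrDl mulrAC.
rewrite ler_wpM2r ?exprn_ge0 ?tilt_ge0 //.
have up : (1 + q) ^+ r <= 1 + r%:R * q + (r%:R * q) ^+ 2.
  by apply: exprD1_le_quad => //; lra.
have down : (1 - q) ^+ r <= 1 - r%:R * q + (r%:R * q) ^+ 2.
  have := @exprD1_le_quad _ (- q) r; rewrite mulrN sqrrN; apply; first by lra.
  by have : 0 <= r%:R * q := mulr_ge0 (ler0n _ _) q0; lra.
by lra.
Qed.

End UpwardJump.

Section Persistence.
Variables (R : realFieldType) (I : finType) (q : R) (r : nat).
Hypothesis q01 : 0 <= q <= 1.
Hypothesis r_gt0 : (0 < r)%N.
Hypothesis rq_small : 2 * #|I|%:R * (r%:R * q) ^+ 2 <= 1.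
Implicit Types (x y m : bits I) (i j : I) (s : seq I) (f : bits I -> bool).

Definition total_influence f : R := \E_(x ~ fair_bits) \sum_i (sensitive f x i)%:R.

Definition instability f y : R := \E_(m ~ mask I q01) (f y != f (bits_or y m))%:R.

Lemma expect_tilt_exp_le2 s : uniq s -> \E_(x ~ fair_bits) tilt q s x ^+ r <= 2.
Proof.
move=> us; have size_s : (size s <= #|I|)%N by rewrite -(card_uniqP us) max_card.
have [->|s_neq0] := eqVneq s [::].
  by under eq_expect do rewrite /tilt big_nil expr1n; rewrite expect_const; lra.
have I_ge1 : 1 <= #|I|%:R :> R by rewrite ler1n (leq_trans _ size_s) // lt0n size_eq0.
have rq0 : 0 <= r%:R * q by rewrite mulr_ge0 //; case/andP: q01.
have rq1 : r%:R * q <= 1.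
  by rewrite -(@expr_le1 _ 2) //; move: rq_small (sqr_ge0 (r%:R * q)); nra.
apply: le_trans (expect_tilt_exp q01 us rq1) _.
apply: exprD1_le2; rewrite ?sqr_ge0 //; apply: le_trans rq_small.
by rewrite ler_wpM2r ?sqr_ge0 // ler_pM2l // ler_nat.
Qed.

Lemma expect_or_on_le s (P : pred (bits I)) : uniq s ->
  \E_(x ~ fair_bits) \E_(m ~ mask I q01) (P (bits_or_on s x m))%:R
  <= 2 * \E_(x ~ fair_bits) (P x)%:R + 4 / 2 ^+ r.
Proof.
move=> us; rewrite (expect_or_on q01 (fun x => (P x)%:R)) //.
apply: le_trans (_ : _ <= 2 * \E_(x ~ fair_bits) (P x)%:R
    + 2 / 2 ^+ r * \E_(x ~ fair_bits) tilt q s x ^+ r) _.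
  rewrite -!expectZ -expectD; apply: le_expect => x.
  have tilt0 := tilt_ge0 q01 s x; have := le_two_add_expr r_gt0 tilt0.
  have : 0 <= 2 / 2 ^+ r * tilt q s x ^+ r by rewrite mulr_ge0 ?divr_ge0 ?exprn_ge0.
  by case: (P x) => /=; lra.
have := ler_wpM2l (_ : 0 <= 2 / 2 ^+ r) (expect_tilt_exp_le2 us).
by rewrite divr_ge0 ?exprn_ge0 // => /(_ isT); lra.
Qed.

Lemma expect_instability_on f s : uniq s ->
  \E_(x ~ fair_bits) \E_(m ~ mask I q01) (f x != f (bits_or_on s x m))%:R
  <= q * \sum_(i <- s) (\E_(x ~ fair_bits) (sensitive f x i)%:R + 4 / 2 ^+ r).
Proof.
have /andP [q0 q1] := q01; elim: s => [_|i s IH /= /andP [is_ us]].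
  rewrite big_nil mulr0; under eq_expect do under eq_expect do rewrite bits_or_on_nil eqxx.
  by under eq_expect do rewrite expect_const; rewrite expect_const.
pose lifts x := f x != f (upd x i true).
apply: le_trans (_ : _ <= \E_(x ~ fair_bits) (
    \E_(m ~ mask I q01) (f x != f (bits_or_on s x m))%:R
    + q * \E_(m ~ mask I q01) (lifts (bits_or_on s x m))%:R)) _.
  apply: le_expect => x; rewrite (expect_or_on_cons q01 x (fun y => (f x != f y)%:R)) //.
  rewrite -expectZ -expectD; apply: le_expect => m; rewrite /lifts.
  by case: (f x); case: (f _); case: (f _) => /=; lra.
rewrite expectD expectZ big_cons mulrDr addrC lerD // ?IH // ler_wpM2l //.
apply: le_trans (expect_or_on_le lifts us) _; rewrite lerD2r -expectZ.
rewrite (expect_fair_coord i) [leRHS](expect_fair_coord i); apply: le_expect => x.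
by rewrite /lifts /sensitive !upd_upd eqxx /=; lra.
Qed.

Lemma expect_instability f :
  \E_(x ~ fair_bits) instability f x
  <= q * (total_influence f + 4 * #|I|%:R / 2 ^+ r).
Proof.
have := expect_instability_on f (enum_uniq I).
under eq_expect do under eq_expect do rewrite bits_or_on_enum.
move=> /le_trans; apply; rewrite ler_wpM2l ?(andP q01).1 //.
rewrite /total_influence expect_sum big_split /= !big_enum /= lerD2l sumr_const.
by rewrite -[_ *+ _]mulr_natl mulrA [_ * 4]mulrC.
Qed.

End Persistence.

(** * Jumping along violated edges *)

Section Hits.
Variables (R : realFieldType) (I : finType) (q : R).
Hypothesis q01 : 0 <= q <= 1.
Implicit Types (m x : bits I) (j k : I) (B : {set I}) (f : bits I -> bool).
Local Notation mask := (mask I q01).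

Definition hits B m : R := \sum_(j in B) (m j)%:R.

Lemma expect_mask_coord j : \E_(m ~ mask) (m j)%:R = q.
Proof.
rewrite (expect_resample _ j) -[RHS](expect_const mask); apply: eq_expect => m.
by rewrite expect_bernoulli !upd_at /=; ring.
Qed.

Lemma expect_mask_coord2 j k :
  \E_(m ~ mask) (m j && m k)%:R <= q ^+ 2 + (j == k)%:R * q.
Proof.
have [<-|jk] := eqVneq j k.
  under eq_expect do rewrite andbb.
  by rewrite expect_mask_coord mul1r lerDr sqr_ge0.
rewrite mul0r addr0 (expect_resample _ j) expr2 -[X in q * X](expect_mask_coord k).
rewrite -expectZ; apply: le_expect => m.
by rewrite expect_bernoulli !upd_at /= upd_neq 1?eq_sym // mulr0 add0r.
Qed.

Lemma expect_hits B : \E_(m ~ mask) hits B m = q * #|B|%:R.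
Proof.
rewrite expect_sum; under eq_bigr do rewrite expect_mask_coord.
by rewrite sumr_const mulr_natr.
Qed.

Lemma expect_hits_sqr_le B :
  \E_(m ~ mask) hits B m ^+ 2 <= (q * #|B|%:R) ^+ 2 + q * #|B|%:R.
Proof.
have -> : \E_(m ~ mask) hits B m ^+ 2
    = \sum_(j in B) \sum_(k in B) \E_(m ~ mask) (m j && m k)%:R.
  under [RHS]eq_bigr do rewrite -expect_sum; rewrite -expect_sum.
  apply: eq_expect => m; rewrite expr2 mulr_suml; apply: eq_bigr => j _.
  by rewrite mulr_sumr; apply: eq_bigr => k _; rewrite -natrM mulnb.
have -> : (q * #|B|%:R) ^+ 2 + q * #|B|%:R = \sum_(j in B) (q ^+ 2 * #|B|%:R + q).
  by rewrite sumr_const -mulr_natr; ring.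
apply: ler_sum => j jB; apply: le_trans (ler_sum _ (fun k _ => expect_mask_coord2 j k)) _.
rewrite big_split /= sumr_const mulr_natr lerD2l (bigD1 j) //= eqxx mul1r big1 ?addr0 //.
by move=> k /andP [_ kj]; rewrite eq_sym (negbTE kj) mul0r.
Qed.

Lemma expect_hits_unstable f x B : f x -> (forall j, j \in B -> violated f x j) ->
  \E_(m ~ mask) (hits B m * (f (bits_or x m))%:R)
  = q * \sum_(j in B) instability q01 f (flip x j).
Proof.
move=> fx viol; under eq_expect do rewrite mulr_suml.
rewrite expect_sum mulr_sumr; apply: eq_bigr => j /viol vj.
rewrite (expect_resample _ j) /instability -expectZ; apply: eq_expect => m.
rewrite expect_bernoulli !upd_at mul0r mulr0 add0r mul1r (violated_value_flip vj) fx /=.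
have -> : bits_or x (upd m j true) = bits_or (flip x j) m.
  apply/ffunP => k; rewrite !ffunE; have [->|//] := eqVneq k j.
  by rewrite (violated_coord vj) fx orbT.
by case: (f _).
Qed.

(* With [c] the number of violated directions in the mask, the indicator of
   [f (x \/ m) = 0] is at least [2c - c^2 - c [f (x \/ m) = 1]]. *)
Lemma expect_jump_ge f x B d : f x -> (forall j, j \in B -> violated f x j) ->
  (d <= #|B| <= 2 * d)%N -> 4 * d%:R * q <= 1 ->
  q * d%:R / 2 - q * \sum_(j in B) instability q01 f (flip x j)
  <= \E_(m ~ mask) (~~ f (bits_or x m))%:R.
Proof.
move=> fx viol /andP [dB Bd] dq; have /andP [q0 _] := q01.
have hits_nat m : hits B m = (\sum_(j in B) m j)%N%:R by rewrite natr_sum.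
apply: le_trans (_ : _ <= \E_(m ~ mask)
    (2 * hits B m - hits B m ^+ 2 - hits B m * (f (bits_or x m))%:R)) _; last first.
  apply: le_expect => m; rewrite hits_nat; move: (\sum_(_ in _) _)%N => c.
  case: (f _) => /=; last first.
    by have := sqr_ge0 (c%:R - 1 : R); rewrite mulr0 subr0 sqrrB1 mulr2n; lra.
  rewrite mulr1; case: c => [|c]; first by rewrite expr0n /=; lra.
  by have : 0 <= c%:R :> R by []; rewrite -natr1; nra.
rewrite !expectB expectZ expect_hits expect_hits_unstable // lerD2r.
have := expect_hits_sqr_le B; set b : R := #|B|%:R.
have db : d%:R <= b by rewrite ler_nat.
have bd : b <= 2 * d%:R by rewrite -natrM ler_nat.
by have := ler_wpM2l q0 db; have := ler_wpM2l q0 bd; have : 0 <= d%:R :> R by []; nra.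
Qed.

End Hits.

Record violation_graph (I : finType) (f : bits I -> bool) (V : pred (bits I))
    (A : bits I -> {set I}) (d : nat) : Prop := ViolationGraph {
  graph_source : forall x, V x -> f x;
  graph_violated : forall x j, V x -> j \in A x -> violated f x j;
  graph_outdegree : forall x, V x -> (d <= #|A x| <= 2 * d)%N;
  graph_indegree : forall y, (#|[set j | V (flip y j) && (j \in A (flip y j))]| <= 4 * d)%N
}.

Definition jump_success (R : realFieldType) (I : finType) (q : R) (q01 : 0 <= q <= 1)
    (f : bits I -> bool) : R :=
  \E_(x ~ fair_bits) \E_(m ~ mask I q01) (f x && ~~ f (bits_or x m))%:R.

Section GraphJump.
Variables (R : realFieldType) (I : finType) (f : bits I -> bool).
Variables (V : pred (bits I)) (A : bits I -> {set I}) (d : nat).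
Hypothesis graph : violation_graph f V A d.
Let density : R := \E_(x ~ fair_bits) (V x)%:R.

Lemma expect_out_neighbours_le (F : bits I -> R) : (forall y, 0 <= F y) ->
  \E_(x ~ fair_bits) \sum_(j | V x && (j \in A x)) F (flip x j)
  <= 4 * d%:R * \E_(y ~ fair_bits) F y.
Proof.
move=> F0; under eq_expect do rewrite big_mkcond.
rewrite expect_sum -expectZ.
under eq_bigr => j _ do rewrite -(expect_flip j).
rewrite -expect_sum; apply: le_expect => y.
under eq_bigr do rewrite flipK.
rewrite -big_mkcond sumr_const -[_ *+ _]mulr_natl ler_wpM2r // -natrM ler_nat.
by rewrite -cardsE (graph_indegree graph).
Qed.

Lemma density_outdegree_le : density * d%:R <= total_influence R f.
Proof.
rewrite mulrC -expectZ; apply: le_expect => x.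
have [Vx|_] := boolP (V x); last by rewrite mulr0 sumr_ge0.
have /andP [dA _] := graph_outdegree graph Vx.
rewrite mulr1; apply: le_trans (_ : _ <= #|A x|%:R) _; first by rewrite ler_nat.
rewrite -sum1_card natr_sum big_mkcond; apply: ler_sum => j _; case: ifP => // jA.
by rewrite (violated_sensitive (graph_violated graph Vx jA)).
Qed.

Lemma jump_success_ge (q : R) (q01 : 0 <= q <= 1) : 4 * d%:R * q <= 1 ->
  q * d%:R * (density / 2 - 4 * \E_(x ~ fair_bits) instability q01 f x)
  <= jump_success q01 f.
Proof.
move=> dq; have /andP [q0 _] := q01.
have instability_ge0 y : 0 <= instability q01 f y by apply: expect_ge0.
have := ler_wpM2l q0 (expect_out_neighbours_le instability_ge0).
set unstable := \E_(x ~ _) _; set inst := \E_(x ~ _) _ => unstable_le.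
apply: le_trans (_ : _ <= q * d%:R / 2 * density - q * unstable) _; first by lra.
rewrite -!expectZ -expectB; apply: le_expect => x.
have [Vx|_] /= := boolP (V x); last first.
  by rewrite big_pred0 // !mulr0 subr0; apply: expect_ge0.
have fx := graph_source graph Vx; rewrite mulr1 fx.
apply: (expect_jump_ge q01 (B := A x)) => // [j jA|].
  exact: (graph_violated graph Vx jA).
exact: (graph_outdegree graph Vx).
Qed.

End GraphJump.

(** * Influence and duality *)

Lemma expect_le_sqrt (R : rcfType) (T : finType) (mu : pmf R T) (F : T -> R) :
  \E_(t ~ mu) F t <= Num.sqrt (\E_(t ~ mu) F t ^+ 2).
Proof.
set a := \E_(t ~ mu) F t.
apply: le_trans (ler_norm _) _; rewrite -sqrtr_sqr ler_wsqrtr //.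
have : 0 <= \E_(t ~ mu) (F t ^+ 2 - (2 * a * F t - a ^+ 2)).
  by apply: expect_ge0 => t; have := sqr_ge0 (F t - a); rewrite sqrrB -mulr_natl; lra.
by rewrite !expectB expectZ expect_const -/a; lra.
Qed.

Section Influence.
Variables (R : rcfType) (I : finType).
Implicit Types (f : bits I -> bool) (x : bits I) (i : I).

Definition spin x i : R := if x i then 1 else -1.

Lemma expect_sum_spin_sqr : \E_(x ~ fair_bits) (\sum_i spin x i) ^+ 2 = #|I|%:R.
Proof.
have -> : \E_(x ~ fair_bits) (\sum_i spin x i) ^+ 2
    = \sum_i \sum_k \E_(x ~ fair_bits) (spin x i * spin x k).
  under [RHS]eq_bigr do rewrite -expect_sum; rewrite -expect_sum.
  apply: eq_expect => x; rewrite expr2 mulr_suml; apply: eq_bigr => i _.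
  by rewrite mulr_sumr.
rewrite -sum1_card natr_sum; apply: eq_bigr => i _; rewrite (bigD1 i) //= big1 ?addr0.
  rewrite -[RHS](expect_const (@fair_bits R I)); apply: eq_expect => x.
  by rewrite /spin; case: (x i); rewrite ?mulrNN mulr1.
move=> k ki; rewrite (expect_fair_coord i) -[RHS](expect_const (@fair_bits R I)).
by apply: eq_expect => x; rewrite /spin !upd_at !upd_neq //=; case: (x k); lra.
Qed.

Lemma signed_influence_le f :
  \E_(x ~ fair_bits) \sum_i ((f (upd x i true))%:R - (f (upd x i false))%:R)
  <= 2 * Num.sqrt #|I|%:R :> R.
Proof.
have -> : \E_(x ~ fair_bits) \sum_i ((f (upd x i true))%:R - (f (upd x i false))%:R)
    = 2 * \E_(x ~ fair_bits) ((f x)%:R * \sum_i spin x i) :> R.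
  under [in RHS]eq_expect do rewrite mulr_sumr.
  rewrite !expect_sum mulr_sumr; apply: eq_bigr => i _.
  rewrite [in RHS](expect_fair_coord i) -expectZ; apply: eq_expect => x.
  by rewrite /spin !upd_at; field.
rewrite ler_pM2l //; apply: le_trans (expect_le_sqrt _ _) _; apply: ler_wsqrtr.
rewrite -expect_sum_spin_sqr; apply: le_expect => x.
by case: (f x); rewrite ?mul1r // mul0r expr0n sqr_ge0.
Qed.

Lemma total_influence_le f :
  total_influence R f <= 2 * neg_influence R f + 2 * Num.sqrt #|I|%:R.
Proof.
apply: le_trans (lerD (lexx _) (signed_influence_le f)).
rewrite -expectZ -expectD; apply: le_expect => x; rewrite mulr_sumr -big_split.
apply: ler_sum => i _; rewrite /sensitive /violated /=.
by case: (f _); case: (f _) => /=; lra.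
Qed.

End Influence.

Section Duality.
Variable I : finType.
Implicit Types (f : bits I -> bool) (x : bits I) (A : bits I -> {set I}).

Definition dual f x := ~~ f (bits_not x).

Lemma violated_dual f x j : violated (dual f) x j = violated f (bits_not x) j.
Proof. by rewrite /violated /dual !bits_not_upd negbK andbC. Qed.

Lemma total_influence_dual (R : realFieldType) f :
  total_influence R (dual f) = total_influence R f.
Proof.
rewrite /total_influence -[RHS]expect_bits_not; apply: eq_expect => x.
apply: eq_bigr => i _; rewrite /sensitive /dual !bits_not_upd /=.
by case: (f _); case: (f _).
Qed.

Lemma orientation_dual f A : orientation f A -> orientation (dual f) (A \o bits_not).
Proof.
move=> /orientationP orA; apply/orientationP => x j.
by rewrite violated_dual -orA /= bits_not_flip.
Qed.

Lemma balanced_dual A : balanced A -> balanced (A \o bits_not).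
Proof.
move=> balA y t; apply: leq_trans (balA (bits_not y) t); apply: subset_leq_card.
by apply/subsetP => j; rewrite !inE /= bits_not_flip.
Qed.

Lemma level_density_dual (R : rcfType) f A k :
  level_density R (dual f) (A \o bits_not) k true = level_density R f A k false.
Proof.
rewrite /level_density -[RHS]expect_bits_not; apply: eq_expect => x.
by rewrite /level /dual /=; case: (f _).
Qed.

Lemma level_graph f A k : orientation f A -> balanced A ->
  violation_graph f (level f A k true) A (2 ^ k).
Proof.
move=> orA balA.
have outdegree x : level f A k true x -> (2 ^ k <= #|A x| <= 2 * 2 ^ k)%N.
  by move=> /andP [_ /andP [-> /ltnW]]; rewrite expnS.
split=> // [x /andP [/eqP ->]|x j _|y] //; first exact: orientation_violated.
apply: leq_trans (_ : _ <= 2 * (2 * 2 ^ k))%N _; last by rewrite mulnA.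
apply: leq_trans (balA y (2 * 2 ^ k)%N); apply: subset_leq_card.
by apply/subsetP => j; rewrite !inE => /andP [/outdegree /andP [_ ->] ->].
Qed.

End Duality.

(** * Detecting functions far from increasing *)

Section Detection.
Variables (R : rcfType) (I : finType) (l : nat).
Hypotheses (I_gt0 : (0 < #|I|)%N).
Implicit Types (f : bits I -> bool) (A : bits I -> {set I}).
Local Notation N := (Num.sqrt #|I|%:R).

Lemma sqrt_card_ge1 : 1 <= N :> R.
Proof. exact: sqrt_nat_ge1. Qed.

Definition jump_rate (t : nat) : R := 2^-1 ^+ t / (80 * l%:R * N).

Lemma jump_rate_bounds t : 0 <= jump_rate t <= 1.
Proof.
rewrite /jump_rate; have := sqrt_card_ge1.
have u0 : 0 <= 2^-1 ^+ t :> R by rewrite exprn_ge0 // invr_ge0.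
have u1 : 2^-1 ^+ t <= 1 :> R by rewrite exprn_ile1 // ?invr_ge0 //; lra.
case: l => [|l'] N1; first by rewrite mulr0 mul0r invr0 mulr0 lexx ler01.
have l1 : 1 <= l'.+1%:R :> R by rewrite ler1n.
have lN : 1 <= 80 * l'.+1%:R * N :> R by nra.
by rewrite divr_ge0 ?ler_pdivrMr ?mul1r ?(le_trans u1) //; lra.
Qed.

Section Level.
Variables (f : bits I -> bool) (A : bits I -> {set I}) (k t : nat).
Hypotheses (l_gt0 : (0 < l)%N) (l_large : 4 * #|I|%:R <= 2 ^+ l :> R).
Hypotheses (orA : orientation f A) (balA : balanced A).
Hypothesis small_influence : total_influence R f <= 4 * N.
Let density := level_density R f A k true.
Hypothesis rate_density : density / 2 <= 2^-1 ^+ t <= density.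

Lemma rate_density_bounds :
  density / 160 <= jump_rate t * (l%:R * N) <= density / 80.
Proof.
have N1 := sqrt_card_ge1; have l1 : 1 <= l%:R :> R by rewrite ler1n.
have -> : jump_rate t * (l%:R * N) = 2^-1 ^+ t / 80.
  by rewrite /jump_rate; field; rewrite !gt_eqF //; lra.
by move: rate_density; lra.
Qed.

Lemma rate_sqrt_card_le : jump_rate t * N <= density / 80.
Proof.
have /andP [q0 _] := jump_rate_bounds t; have /andP [_ qlN] := rate_density_bounds.
by apply: le_trans qlN; rewrite ler_wpM2l // ler_peMl ?sqrtr_ge0 // ler1n.
Qed.

Lemma rate_outdegree_le : 4 * (2 ^ k)%:R * jump_rate t <= 1.
Proof.
have influence : density * (2 ^ k)%:R <= 4 * N.
  exact: le_trans (density_outdegree_le R (level_graph k orA balA)) small_influence.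
set d : R := (2 ^ k)%:R in influence *.
have d0 : 0 <= d by []; have dqN := ler_wpM2l d0 rate_sqrt_card_le.
have N1 := sqrt_card_ge1; rewrite -(ler_pM2r (lt_le_trans ltr01 N1)); lra.
Qed.

Lemma level_stable :
  \E_(x ~ fair_bits) instability (jump_rate_bounds t) f x <= density / 16.
Proof.
have /andP [q0 _] := jump_rate_bounds t; have N1 := sqrt_card_ge1.
have /andP [_ qlN] := rate_density_bounds.
have /andP [_ density1] := level_density_bounds R f A k true.
have lq_small : 2 * #|I|%:R * (l%:R * jump_rate t) ^+ 2 <= 1.
  have -> : 2 * #|I|%:R * (l%:R * jump_rate t) ^+ 2
      = 2 * (jump_rate t * (l%:R * N)) ^+ 2.
    by rewrite -[in LHS](sqr_sqrt_nat R #|I|); ring.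
  have := mulr_ge0 q0 (mulr_ge0 (ler0n R l) (sqrtr_ge0 #|I|%:R)).
  by rewrite -/density in density1; nra.
apply: le_trans (expect_instability _ l_gt0 lq_small f) _.
have tail : 4 * #|I|%:R / 2 ^+ l <= 1 :> R by rewrite ler_pdivrMr ?exprn_gt0 // mul1r.
apply: le_trans (_ : _ <= jump_rate t * (4 * N + N)) _.
  by rewrite ler_wpM2l // lerD // (le_trans tail).
by have := rate_sqrt_card_le; lra.
Qed.

Lemma level_jump_success :
  density ^+ 2 * 2 ^+ k / (640 * l%:R * N) <= jump_success (jump_rate_bounds t) f.
Proof.
have N1 := sqrt_card_ge1; have l1 : 1 <= l%:R :> R by rewrite ler1n.
have lN1 : 1 <= l%:R * N :> R by rewrite mulr_ege1.
have /andP [density0 _] : 0 <= density <= 1 := level_density_bounds _ _ _ _ _.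
have q_ge : density / (160 * (l%:R * N)) <= jump_rate t.
  by rewrite invfM mulrA ler_pdivrMr; [case/andP: rate_density_bounds | lra].
have graph := level_graph k orA balA.
apply: le_trans (jump_success_ge graph _ rate_outdegree_le).
rewrite natrX -/(level_density _ _ _ _ _) -/density.
have -> : density ^+ 2 * 2 ^+ k / (640 * l%:R * N)
    = density / (160 * (l%:R * N)) * 2 ^+ k * (density / 4).
  by field; rewrite !gt_eqF //; lra.
apply: ler_pM; last by have := level_stable; lra.
- by rewrite mulr_ge0 ?exprn_ge0 // divr_ge0 //; lra.
- by lra.
- by rewrite ler_wpM2r // exprn_ge0.
Qed.

End Level.

Lemma dyadic_approx (x : R) n : 2^-1 ^+ n <= x <= 1 ->
  exists2 t, (t <= n)%N & x / 2 <= 2^-1 ^+ t <= x.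
Proof.
move=> /andP [n_ok x1].
have [//|t t_ok t_min] := @ex_minnP (fun t => 2^-1 ^+ t <= x); first by exists n.
exists t; rewrite ?t_min //= t_ok andbT.
case: t t_ok t_min => [_ _|t _ t_min]; first by rewrite expr0; lra.
by rewrite exprS; have [/t_min|] := leP (2^-1 ^+ t) x; [rewrite ltnn | lra].
Qed.

Section FarFromIncreasing.
Variable eps : R.
Hypotheses (eps_gt0 : 0 < eps) (eps_le1 : eps <= 1).
Hypothesis l_large : 4 * #|I|%:R / eps <= 2 ^+ l.

Lemma four_card_le_exp : 4 * #|I|%:R <= eps * 2 ^+ l.
Proof. by rewrite [leRHS]mulrC -ler_pdivrMr. Qed.

Lemma four_le_exp : 4 <= eps * 2 ^+ l.
Proof.
have : 1 <= #|I|%:R :> R by rewrite ler1n.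
by have := four_card_le_exp; lra.
Qed.

Lemma exponent_gt0 : (0 < l)%N.
Proof.
rewrite lt0n; apply/eqP => l0; have := four_le_exp; rewrite l0 expr0.
by have := eps_le1; lra.
Qed.

Lemma sqrt_size_ge f A : orientation f A -> far_from_increasing eps f ->
  eps / (8 * l%:R) <= sqrt_size R A.
Proof.
move=> orA far; have eps0 := eps_gt0.
have l1 : 1 <= l%:R :> R by rewrite ler1n exponent_gt0.
rewrite ler_pdivrMr; last by lra.
have := directed_talagrand (fun j => orientation_covers orA) l far.
have : #|I|%:R / 2 ^+ l <= eps / 4.
  by rewrite ler_pdivrMr ?exprn_gt0 //; have := four_card_le_exp; lra.
by lra.
Qed.

Lemma card_lt_exp : (#|I| < 2 ^ l)%N.
Proof.
rewrite -(ltr_nat R) natrX; have := four_card_le_exp.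
have : eps * 2 ^+ l <= 2 ^+ l by rewrite ler_piMl // exprn_ge0.
have : 1 <= #|I|%:R :> R by rewrite ler1n.
by lra.
Qed.

Lemma heavy_level_density f A : orientation f A -> far_from_increasing eps f ->
  exists k b, (k < l)%N /\ eps ^+ 2 / (512 * l%:R ^+ 4)
    <= level_density R f A k b ^+ 2 * 2 ^+ k.
Proof.
move=> orA far; have l1 : 1 <= l%:R :> R by rewrite ler1n exponent_gt0.
have [k [b [kl heavy]]] := heavy_level R f A exponent_gt0 card_lt_exp.
exists k, b; split=> //; move: heavy; set s := level_density _ _ _ _ _ => heavy.
have /andP [s0 _] : 0 <= s <= 1 := level_density_bounds _ _ _ _ _.
set u := _ * s in heavy; have u0 : 0 <= u by rewrite mulr_ge0 ?sqrtr_ge0.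
have u_sqr : u ^+ 2 = 2 * 2 ^+ k * s ^+ 2.
  by rewrite exprMn sqr_sqrtr ?exprn_ge0 // exprS.
have eps0 := eps_gt0; have {}heavy : eps <= 16 * l%:R ^+ 2 * u.
  move: (le_trans (sqrt_size_ge orA far) heavy).
  by rewrite natrM ler_pdivrMr; [move: (u) => v; nra | lra].
have : eps ^+ 2 <= (16 * l%:R ^+ 2 * u) ^+ 2 by rewrite lerXn2r ?nnegrE //; nra.
rewrite exprMn u_sqr => heavy_sqr.
have l0 : 0 < l%:R :> R by lra.
rewrite ler_pdivrMr ?mulr_gt0 //.
by apply: le_trans heavy_sqr _; rewrite le_eqVlt; apply/orP; left; apply/eqP; ring.
Qed.

Lemma heavy_density_ge (s : R) k : (k < l)%N -> 0 <= s ->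
  eps ^+ 2 / (512 * l%:R ^+ 4) <= s ^+ 2 * 2 ^+ k -> 2^-1 ^+ (6 * l) <= s.
Proof.
move=> kl s0; pose X : R := 2 ^+ l; have eX : 4 <= eps * X := four_le_exp.
have eps0 := eps_gt0; have eps1 := eps_le1.
have X4 : 4 <= X by nra.
have l0 : 0 < l%:R :> R by rewrite ltr0n exponent_gt0.
have lX : l%:R ^+ 4 <= X ^+ 4.
  by rewrite lerXn2r ?nnegrE ?exprn_ge0 // /X -natrX ler_nat ltnW // ltn_expl.
have kX : 2 ^+ k <= X by rewrite ler_weXn2l ?ler1n // ltnW.
have X5 : l%:R ^+ 4 * 2 ^+ k <= X ^+ 5.
  by rewrite [leRHS]exprSr ler_pM ?exprn_ge0 // ltW.
rewrite ler_pdivrMr ?mulr_gt0 // => heavy.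
have {}heavy : 16 <= 512 * X ^+ 7 * s ^+ 2.
  have : 4 ^+ 2 <= (eps * X) ^+ 2 by rewrite lerXn2r ?nnegrE //; lra.
  have := ler_wpM2l (sqr_ge0 X) heavy.
  have := ler_wpM2l (mulr_ge0 (sqr_ge0 X) (sqr_ge0 s)) X5.
  rewrite exprMn !exprS !expr0; lra.
have X0 : 0 < X by lra.
have {}heavy : 1 <= s ^+ 2 * X ^+ 12.
  have X7s : 0 <= X ^+ 7 * s ^+ 2 by rewrite mulr_ge0 ?sqr_ge0 ?exprn_ge0 ?ltW.
  have : 4 ^+ 5 <= X ^+ 5 by rewrite lerXn2r ?nnegrE // ltW.
  by move/(ler_wpM2r X7s); rewrite [X in _ <= X -> _]mulrA -exprD; lra.
rewrite -ler_sqr ?nnegrE ?exprn_ge0 ?invr_ge0 // -exprM mulnAC mulnC exprM exprVn -/X.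
by rewrite exprVn -[leLHS]mul1r ler_pdivrMr ?exprn_gt0.
Qed.

Definition detection_bound : R := eps ^+ 2 / (512 * 640 * l%:R ^+ 5 * N).

Lemma detection_bound_ge0 : 0 <= detection_bound.
Proof. by rewrite divr_ge0 ?sqr_ge0 // !mulr_ge0 ?exprn_ge0 ?sqrtr_ge0. Qed.

Lemma detection_bound_le : detection_bound <= N^-1.
Proof.
have l5 : 1 <= l%:R ^+ 5 :> R by rewrite exprn_ege1 // ler1n exponent_gt0.
have N0 : 0 < N :> R := lt_le_trans ltr01 sqrt_card_ge1.
rewrite ler_pdivrMr; last by rewrite mulr_gt0 //; lra.
rewrite mulrC mulfK ?gt_eqF //; apply: le_trans (_ : 1 <= _); last by lra.
by rewrite exprn_ile1 // ltW.
Qed.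

Lemma oriented_detection f A k : orientation f A -> balanced A ->
  total_influence R f <= 4 * N -> (k < l)%N ->
  eps ^+ 2 / (512 * l%:R ^+ 4)
    <= level_density R f A k true ^+ 2 * 2 ^+ k ->
  exists2 t, (t <= 6 * l)%N & detection_bound <= jump_success (jump_rate_bounds t) f.
Proof.
move=> orA balA small kl; set s := level_density _ _ _ _ _ => heavy.
have /andP [s0 s1] : 0 <= s <= 1 := level_density_bounds _ _ _ _ _.
have [t tl t_s] : exists2 t, (t <= 6 * l)%N & s / 2 <= 2^-1 ^+ t <= s.
  by apply: dyadic_approx; rewrite s1 (heavy_density_ge kl).
exists t => //.
have l_large1 : 4 * #|I|%:R <= 2 ^+ l :> R.
  by apply: le_trans four_card_le_exp _; rewrite ler_piMl // exprn_ge0.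
apply: le_trans (level_jump_success exponent_gt0 l_large1 orA balA small t_s).
have l1 : 1 <= l%:R :> R by rewrite ler1n exponent_gt0.
have N1 := sqrt_card_ge1.
have -> : detection_bound = eps ^+ 2 / (512 * l%:R ^+ 4) / (640 * l%:R * N).
  by rewrite /detection_bound; field; rewrite !gt_eqF //; lra.
by rewrite ler_wpM2r // invr_ge0 !mulr_ge0 ?sqrtr_ge0.
Qed.

Lemma far_detection f : far_from_increasing eps f ->
  N^-1 <= #|I|%:R^-1 * neg_influence R f \/
  exists t b, (t <= 6 * l)%N /\
    detection_bound <= jump_success (jump_rate_bounds t) (if b then f else dual f).
Proof.
move=> far; have [big|/ltW small] := leP (4 * N) (total_influence R f).
  left; have N1 := sqrt_card_ge1; have N0 : 0 < N :> R by lra.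
  have big_neg : N <= neg_influence R f.
    by have := le_trans big (total_influence_le R f); lra.
  have -> : N^-1 = #|I|%:R^-1 * N :> R.
    by rewrite -[X in X^-1 * _](sqr_sqrt_nat R #|I|) expr2 invfM mulfVK // gt_eqF.
  by rewrite ler_wpM2l ?invr_ge0 ?ler0n.
right; have [A orA balA] := balanced_orientation f.
have [k [b [kl heavy]]] := heavy_level_density orA far.
case: b heavy => heavy.
  by have [t tl detect] := oriented_detection orA balA small kl heavy; exists t, true.
have small_dual : total_influence R (dual f) <= 4 * N by rewrite total_influence_dual.
have [|t tl detect] := oriented_detection (orientation_dual orA) (balanced_dual balA)
    small_dual kl; last by exists t, false.
by rewrite level_density_dual.
Qed.

End FarFromIncreasing.

End Detection.

(** * Pair tests *)

Record pair_test (R : realFieldType) (I : finType) := PairTest {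
  pair_coins : finType;
  pair_law : pmf R pair_coins;
  pair_low : pair_coins -> bits I;
  pair_high : pair_coins -> bits I;
  pair_le : forall c, bits_le (pair_low c) (pair_high c)
}.

Definition catches (R : realFieldType) (I : finType) (T : pair_test R I)
    (f : bits I -> bool) (c : pair_coins T) : bool :=
  f (pair_low c) && ~~ f (pair_high c).

Definition catch_prob (R : realFieldType) (I : finType) (T : pair_test R I)
    (f : bits I -> bool) : R :=
  \E_(c ~ pair_law T) (catches f c)%:R.

Lemma catch_prob_bounds (R : realFieldType) (I : finType) (T : pair_test R I) f :
  0 <= catch_prob T f <= 1.
Proof. exact: expect_bool_bounds. Qed.

Section EdgeTest.
Variables (R : realFieldType) (I : finType).
Hypothesis I_gt0 : (0 < #|I|)%N.

Lemma upd_le (x : bits I) i : bits_le (upd x i false) (upd x i true).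
Proof. by move=> j; rewrite !ffunE; case: eqP. Qed.

Definition edge_test : pair_test R I :=
  @PairTest R I _ (pmf_pair fair_bits (uniform R I_gt0))
    (fun xi => upd xi.1 xi.2 false) (fun xi => upd xi.1 xi.2 true)
    (fun xi => @upd_le xi.1 xi.2).

Lemma catch_prob_edge f : catch_prob edge_test f = #|I|%:R^-1 * neg_influence R f.
Proof.
rewrite /catch_prob /neg_influence expect_pair -expectZ; apply: eq_expect => x.
by rewrite expect_uniform.
Qed.

End EdgeTest.

Section JumpTest.
Variables (R : realFieldType) (I : finType) (q : R).
Hypothesis q01 : 0 <= q <= 1.

Lemma bits_or_le (x m : bits I) : bits_le x (bits_or x m).
Proof. by move=> j xj; rewrite ffunE xj. Qed.

Definition jump_test : pair_test R I :=
  @PairTest R I _ (pmf_pair fair_bits (mask I q01))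
    (fun xm => xm.1) (fun xm => bits_or xm.1 xm.2) (fun xm => @bits_or_le xm.1 xm.2).

Lemma catch_prob_jump f : catch_prob jump_test f = jump_success q01 f.
Proof. exact: expect_pair. Qed.

End JumpTest.

Section DualTest.
Variables (R : realFieldType) (I : finType) (T : pair_test R I).

Lemma bits_not_le (x y : bits I) : bits_le x y -> bits_le (bits_not y) (bits_not x).
Proof. by move=> xy i; rewrite !ffunE; apply: contra; exact: xy. Qed.

Definition dual_test : pair_test R I :=
  @PairTest R I _ (pair_law T) (fun c => bits_not (pair_high c))
    (fun c => bits_not (pair_low c)) (fun c => bits_not_le (@pair_le _ _ T c)).

Lemma catch_prob_dual f : catch_prob dual_test f = catch_prob T (dual f).
Proof. by apply: eq_expect => c; rewrite /catches /dual negbK andbC. Qed.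

End DualTest.

Section PushforwardTest.
Variables (R : realFieldType) (I K : finType) (T : pair_test R I) (h : bits I -> bits K).
Hypothesis h_mono : forall x y, bits_le x y -> bits_le (h x) (h y).

Definition pushforward_test : pair_test R K :=
  @PairTest R K _ (pair_law T) (fun c => h (pair_low c)) (fun c => h (pair_high c))
    (fun c => h_mono (@pair_le _ _ T c)).

Lemma catch_prob_pushforward f : catch_prob pushforward_test f = catch_prob T (f \o h).
Proof. by []. Qed.

End PushforwardTest.

Section MixedTest.
Variables (R : realFieldType) (I J : finType) (T : J -> pair_test R I).
Hypothesis J_gt0 : (0 < #|J|)%N.

Definition mixed_test : pair_test R I :=
  @PairTest R I _ (pmf_sig (uniform R J_gt0) (fun j => pair_law (T j)))
    (fun c => pair_low (tagged c)) (fun c => pair_high (tagged c))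
    (fun c => @pair_le _ _ (T (tag c)) (tagged c)).

Lemma catch_prob_mixed j f : catch_prob (T j) f / #|J|%:R <= catch_prob mixed_test f.
Proof.
rewrite /catch_prob expect_sig expect_uniform mulrC ler_wpM2l ?invr_ge0 ?ler0n //.
rewrite [leRHS](bigD1 j) //= lerDl sumr_ge0 // => k _; exact: expect_ge0.
Qed.

End MixedTest.

Section UniformTester.
Variables (R : rcfType) (I : finType) (l : nat).
Hypothesis I_gt0 : (0 < #|I|)%N.

Definition tester_constant : R := 512 * 640 * 15.

Lemma tester_constant_ge1 : 1 <= tester_constant.
Proof. by rewrite /tester_constant; lra. Qed.

Definition uniform_test_family (tag : option ('I_(6 * l).+1 * bool)) : pair_test R I :=
  match tag with
  | None => edge_test R I_gt0
  | Some (t, b) =>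
    let T := jump_test I (jump_rate_bounds R l I_gt0 t) in if b then T else dual_test T
  end.

Lemma card_tags : #|{: option ('I_(6 * l).+1 * bool)}| = (12 * l + 3)%N.
Proof. by rewrite card_option card_prod card_ord card_bool; lia. Qed.

Lemma card_tags_gt0 : (0 < #|{: option ('I_(6 * l).+1 * bool)}|)%N.
Proof. by rewrite card_tags addn3. Qed.

Definition uniform_tester : pair_test R I := mixed_test uniform_test_family card_tags_gt0.

Lemma catch_prob_uniform_tester (eps : R) f : 0 < eps <= 1 ->
  4 * #|I|%:R / eps <= 2 ^+ l -> far_from_increasing eps f ->
  eps ^+ 2 / (tester_constant * l%:R ^+ 6 * Num.sqrt #|I|%:R) <= catch_prob uniform_tester f.
Proof.
move=> /andP [eps0 eps1] l_large far; have N1 := sqrt_card_ge1 R I_gt0.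
have l_gt0 := exponent_gt0 I_gt0 eps0 eps1 l_large.
have l1 : 1 <= l%:R :> R by rewrite ler1n.
pose delta := detection_bound I l eps.
suff [tag tag_catch] : exists tag, delta <= catch_prob (uniform_test_family tag) f.
  apply: le_trans (catch_prob_mixed _ _ tag f); rewrite card_tags.
  apply: le_trans (ler_wpM2r _ tag_catch); last by rewrite invr_ge0 ler0n.
  have -> : eps ^+ 2 / (tester_constant * l%:R ^+ 6 * Num.sqrt #|I|%:R) = delta / (15 * l%:R).
    by rewrite /delta /detection_bound /tester_constant; field; rewrite !gt_eqF //; lra.
  rewrite ler_wpM2l ?detection_bound_ge0 // lef_pV2 ?posrE ?ltr0n ?addn3 //; last by lra.
  by rewrite -natrM ler_nat; move: l_gt0; lia.
case: (far_detection I_gt0 eps0 eps1 l_large far) => [edges|[t [b [tl jumps]]]].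
  exists None; rewrite catch_prob_edge; apply: le_trans edges.
  exact: detection_bound_le.
exists (Some (Ordinal (tl : t < (6 * l).+1)%N, b)).
apply: le_trans jumps _ => /=.
by case: b; rewrite ?catch_prob_dual catch_prob_jump.
Qed.

End UniformTester.

(** * Biased bits as increasing functions of fair bits *)

Section Harris.
Variables (R : realFieldType) (q : R).
Hypothesis q01 : 0 <= q <= 1.

Lemma bernoulli_correlation (F G : bool -> R) :
  F false <= F true -> G false <= G true ->
  (\E_(b ~ bernoulli q01) F b) * (\E_(b ~ bernoulli q01) G b)
  <= \E_(b ~ bernoulli q01) (F b * G b).
Proof.
move=> F_incr G_incr; rewrite !expect_bernoulli -subr_ge0; set gap := (X in 0 <= X).
have -> : gap = q * (1 - q) * ((F true - F false) * (G true - G false)).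
  by rewrite /gap; ring.
by have /andP [q0 q1] := q01; rewrite !mulr_ge0 ?subr_ge0.
Qed.

Lemma harris k (F G : bits 'I_k -> R) :
  {homo F : x y / bits_le x y >-> x <= y} -> {homo G : x y / bits_le x y >-> x <= y} ->
  (\E_(x ~ mask 'I_k q01) F x) * (\E_(x ~ mask 'I_k q01) G x)
  <= \E_(x ~ mask 'I_k q01) (F x * G x).
Proof.
elim: k F G => [|k IH] F G F_incr G_incr.
  have constant (H : bits 'I_0 -> R) : \E_(x ~ mask 'I_0 q01) H x = H [ffun=> false].
    rewrite -[RHS](expect_const (mask 'I_0 q01)); apply: eq_expect => x.
    by congr H; apply/ffunP => -[].
  by rewrite !constant.
have cons_le (b c : bool) (x y : bits 'I_k) :
    (b -> c) -> bits_le x y -> bits_le (ffun_cons b x) (ffun_cons c y).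
  by move=> bc xy i; rewrite !ffunE; case: (unlift _ _) => [j|] /=; [exact: xy|].
rewrite /mask !expect_ffun_cons; apply: le_trans (bernoulli_correlation _ _) _.
- by apply: le_expect => x; apply/F_incr/cons_le.
- by apply: le_expect => x; apply/G_incr/cons_le.
apply: le_expect => b; apply: IH => x y xy.
- by apply/F_incr/cons_le.
- by apply/G_incr/cons_le.
Qed.

End Harris.

Lemma increasing_bit_approx (R : realFieldType) (p : R) k : 0 <= p <= 1 ->
  exists2 phi : bits 'I_k -> bool, increasing phi
    & `|\E_(u ~ fair_bits) (phi u)%:R - p| <= 2^-1 ^+ k.
Proof.
elim: k p => [|k IH] p p01.
  by exists xpredT; rewrite //= expect_const expr0 ler_norml; lra.
have behead_le (u v : bits 'I_k.+1) : bits_le u v -> bits_le (ffun_behead u) (ffun_behead v).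
  by move=> uv j; rewrite !ffunE; exact: uv.
have [p_ge|/ltW p_le] := leP 2^-1 p.
  have [|phi incr approx] := IH (2 * p - 1); first by lra.
  exists (fun u : bits 'I_k.+1 => u ord0 || phi (ffun_behead u)).
    by move=> u v uv /orP [/uv ->//|/(incr _ _ (behead_le _ _ uv)) ->]; rewrite orbT.
  rewrite /fair_bits expect_ffun_cons expect_fair_bit.
  under eq_expect do rewrite ffun_cons0 ffun_consK.
  under [X in (_ + X) / 2]eq_expect do rewrite ffun_cons0.
  by rewrite /= expect_const exprS; move: approx; rewrite !ler_norml; lra.
have [|phi incr approx] := IH (2 * p); first by lra.
exists (fun u : bits 'I_k.+1 => u ord0 && phi (ffun_behead u)).
  by move=> u v uv /andP [/uv -> /(incr _ _ (behead_le _ _ uv)) ->].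
rewrite /fair_bits expect_ffun_cons expect_fair_bit.
under eq_expect do rewrite ffun_cons0.
under [X in (_ + X) / 2]eq_expect do rewrite ffun_cons0 ffun_consK.
by rewrite /= expect_const exprS; move: approx; rewrite !ler_norml; lra.
Qed.

Section Rounding.
Variables (R : realFieldType) (J : finType) (k : nat) (phi : bits 'I_k -> bool).
Hypothesis phi_increasing : increasing phi.
Implicit Types (U V : {ffun J -> bits 'I_k}) (x : bits J) (i j : J).
Local Notation blocks := (pmf_ffun J (@fair_bits R 'I_k)).

Definition bit_prob : R := \E_(u ~ fair_bits) (phi u)%:R.

Lemma bit_prob_bounds : 0 <= bit_prob <= 1.
Proof. exact: expect_bool_bounds. Qed.

Definition encode U : bits J := [ffun j => phi (U j)].

Definition code_law : pmf R (bits J) := pmf_ffun J (bernoulli bit_prob_bounds).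

Lemma encode_upd U i u : encode (upd U i u) = upd (encode U) i (phi u).
Proof. by apply/ffunP => j; rewrite !ffunE; case: eqP. Qed.

Lemma expect_encode_eq x : \E_(U ~ blocks) (encode U == x)%:R = code_law x.
Proof.
have prodE U : (encode U == x)%:R = \prod_j (phi (U j) == x j)%:R :> R.
  have [<-|neq] := eqVneq (encode U) x.
    by rewrite big1 // => j _; rewrite ffunE eqxx.
  have [j xj] : exists j, phi (U j) != x j.
    apply/existsP; rewrite -negb_forall; apply: contra neq => /forallP eq_x.
    by apply/eqP/ffunP => j; rewrite ffunE; apply/eqP.
  by rewrite (bigD1 j) //= (negbTE xj) mul0r.
under eq_expect do rewrite prodE; rewrite (expect_prod _ (fun j u => (phi u == x j)%:R)).
apply: eq_bigr => j _; case: (x j) => /=; first by apply: eq_expect => u; rewrite eqb_id.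
rewrite -[X in X - _](expect_const (@fair_bits R 'I_k)) -expectB; apply: eq_expect => u.
by case: (phi u); rewrite ?subrr ?subr0.
Qed.

Lemma expect_encode_split (F : bits J -> {ffun J -> bits 'I_k} -> R) :
  \E_(U ~ blocks) F (encode U) U
  = \sum_x \E_(U ~ blocks) ((encode U == x)%:R * F x U).
Proof.
rewrite -expect_sum; apply: eq_expect => U.
rewrite (bigD1 (encode U)) //= eqxx mul1r big1 ?addr0 // => x.
by rewrite eq_sym => /negbTE ->; rewrite mul0r.
Qed.

Variable g : {ffun J -> bits 'I_k} -> bool.
Hypothesis g_increasing : forall U V, (forall j, bits_le (U j) (V j)) -> g U -> g V.

Definition accepted_mass x : R := \E_(U ~ blocks) ((encode U == x) && g U)%:R.

(* Harris' inequality in the [i]-th block. *)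
Lemma accepted_mass_upd x i :
  bit_prob * accepted_mass (upd x i false) <= (1 - bit_prob) * accepted_mass (upd x i true).
Proof.
pose agree U := upd (encode U) i false == upd x i false.
have massE b : accepted_mass (upd x i b) = \E_(U ~ blocks)
    ((agree U)%:R * \E_(u ~ fair_bits) ((phi u == b) && g (upd U i u))%:R).
  rewrite /accepted_mass (expect_resample _ i); apply: eq_expect => U.
  rewrite -expectZ; apply: eq_expect => u; rewrite encode_upd /agree.
  rewrite -natrM mulnb andbA; congr (_ && _)%:R.
  apply/eqP/andP => [eq_upd|[/eqP agr /eqP ->]].
    rewrite (upd_inj eq_upd) eqxx -[upd (encode U) i _](upd_upd _ _ (phi u)).
    by rewrite eq_upd upd_upd eqxx.
  by rewrite -[LHS](upd_upd _ _ false) agr upd_upd.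
rewrite !massE -!expectZ; apply: le_expect => U; rewrite mulrCA [leRHS]mulrCA.
rewrite ler_wpM2l ?ler0n //; set G := fun u => g (upd U i u).
have split_G : \E_(u ~ fair_bits) (G u)%:R
    = \E_(u ~ fair_bits) ((phi u == false) && G u)%:R
      + \E_(u ~ fair_bits) ((phi u == true) && G u)%:R :> R.
  by rewrite -expectD; apply: eq_expect => u; case: (phi u); rewrite ?add0r ?addr0.
have := harris (half_bounds R) (F := fun u => (phi u)%:R) (G := fun u => (G u)%:R).
rewrite -/fair_bit -/fair_bits -/bit_prob split_G.
have -> : \E_(u ~ fair_bits) ((phi u)%:R * (G u)%:R)
    = \E_(u ~ fair_bits) ((phi u == true) && G u)%:R :> R.
  by apply: eq_expect => u; rewrite -natrM mulnb eqb_id.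
have homo_bool (h : bits 'I_k -> bool) : increasing h ->
    {homo (fun u => (h u)%:R : R) : u v / bits_le u v >-> u <= v}.
  by move=> incr u v /incr; case: (h u) => [->|] //; rewrite ler_nat.
have G_increasing : increasing G.
  by move=> u v uv; apply: g_increasing => j l; rewrite !ffunE; case: eqP => // _; exact: uv.
by move=> /(_ (homo_bool _ phi_increasing) (homo_bool _ G_increasing)); lra.
Qed.

(* Majority vote over the fibre of [encode] above [x]. *)
Definition rounding x : bool := code_law x <= 2 * accepted_mass x.

Lemma rounding_increasing : 0 < bit_prob < 1 -> increasing rounding.
Proof.
move=> /andP [P0 P1]; apply: increasing_coordinatewise => i x.
rewrite /violated negb_and negbK -implybE; apply/implyP; rewrite /rounding.
have := accepted_mass_upd x i.
have := ffun_mass_upd (bernoulli bit_prob_bounds) (upd x i false) i true.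
rewrite upd_upd upd_at /= -!/(code_law _) => law_ratio mass_ratio low.
rewrite -(@ler_pM2r _ (1 - bit_prob)) ?subr_gt0 // law_ratio.
by have := ler_wpM2r (ltW P0) low; lra.
Qed.

Lemma rounding_error (f : bits J -> bool) :
  \E_(x ~ code_law) (f x != rounding x)%:R
  <= 2 * \E_(U ~ blocks) (f (encode U) != g U)%:R.
Proof.
rewrite (expect_encode_split (fun x U => (f x != g U)%:R)) mulr_sumr.
apply: ler_sum => x _.
have rejected : \E_(U ~ blocks) ((encode U == x)%:R * (~~ g U)%:R)
    = code_law x - accepted_mass x.
  rewrite -expect_encode_eq -expectB; apply: eq_expect => U.
  by case: (_ == _); case: (g U) => /=; ring.
have accepted : \E_(U ~ blocks) ((encode U == x)%:R * (g U)%:R) = accepted_mass x.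
  by apply: eq_expect => U; rewrite -natrM mulnb.
rewrite /rounding; set w := code_law x in rejected *.
have [vote|vote] := leP w (2 * accepted_mass x); case: (f x) => /=.
all: rewrite ?mulr0 ?mulr1.
- by rewrite mulr_ge0 //; apply: expect_ge0 => U; rewrite mulr_ge0.
- by under eq_expect do rewrite [false == _]eq_sym eqbF_neg negbK; rewrite accepted.
- under eq_expect do rewrite [true == _]eq_sym eqb_id.
  by rewrite rejected; lra.
- by rewrite mulr_ge0 //; apply: expect_ge0 => U; rewrite mulr_ge0.
Qed.

Lemma far_encode (eps : R) (f : bits J -> bool) : 0 < bit_prob < 1 ->
  (forall h, increasing h -> eps <= \E_(x ~ code_law) (f x != h x)%:R) ->
  eps / 2 <= \E_(U ~ blocks) (f (encode U) != g U)%:R.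
Proof.
move=> P01 /(_ _ (rounding_increasing P01)) /le_trans /(_ (rounding_error f)).
by lra.
Qed.

End Rounding.

(** * The biased measure *)

Section BiasedMeasure.
Variables (R : realType) (n : nat) (p : R).
Hypothesis p01 : 0 <= p <= 1.
Implicit Types (f g : boolfun n) (x : cube n).

Definition biased_law : pmf R (bits 'I_n) := pmf_ffun 'I_n (bernoulli p01).

Lemma biasedE x : biased p x = biased_law x.
Proof.
rewrite /biased /hamming_weight cardsE /= (bigID (fun i => x i)) /=; congr (_ * _).
  by rewrite (eq_bigr (fun=> p)) ?prodr_const // => i ->.
rewrite (eq_bigr (fun=> 1 - p)) => [|i /negbTE -> //].
rewrite prodr_const; congr (_ ^+ _).
have -> : #|(fun i => ~~ x i)| = #|[predC (fun i => x i)]| by exact: eq_card.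
by rewrite -[X in (X - _)%N]card_ord -(cardC (fun i => x i)) addKn.
Qed.

Lemma disagreement_biased f g :
  disagreement (biased p) f g = \E_(x ~ biased_law) (f x != g x)%:R.
Proof.
rewrite /disagreement big_mkcond; apply: eq_bigr => x _; rewrite biasedE.
by case: (_ != _); rewrite ?mulr1 ?mulr0.
Qed.

Lemma monotone_increasing f : monotone f -> increasing f.
Proof.
move=> /'forall_forallP mono x y xy; have /implyP := mono x y.
have -> : cube_le x y by apply/forallP => i; have := xy i; case: (x i) => // ->.
by case: (f x) => // /(_ isT); case: (f y).
Qed.

Lemma increasing_monotone (g : bits 'I_n -> bool) :
  increasing g -> monotone ([ffun x => g x] : boolfun n).
Proof.
move=> incr; apply/'forall_forallP => x y; apply/implyP => /forallP xy; rewrite !ffunE.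
have : bits_le x y by move=> i xi; have := xy i; rewrite xi; case: (y i).
by move=> /incr; case: (g x) => // ->.
Qed.

Lemma dist_monotone_le (mu : cube n -> R) f g : monotone g ->
  dist_monotone mu f <= disagreement mu f g.
Proof.
move=> mono_g; rewrite /dist_monotone; case: arg_minP => [|h _]; last exact.
by apply: increasing_monotone => x y.
Qed.

Lemma dist_monotone_biased_le1 f : dist_monotone (biased p) f <= 1.
Proof.
have mono0 : monotone ([ffun=> false] : boolfun n) by apply: increasing_monotone => x y.
apply: le_trans (dist_monotone_le _ _ mono0) _; rewrite disagreement_biased.
by case/andP: (expect_bool_bounds biased_law (fun x => f x != [ffun=> false] x)).
Qed.

End BiasedMeasure.

Lemma dist_monotone_cube0 (R : realType) (mu : cube 0 -> R) (f : boolfun 0) :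
  dist_monotone mu f <= 0.
Proof.
have mono_f : monotone f.
  apply/'forall_forallP => x y; apply/implyP => _.
  by rewrite (_ : x = y) //; apply/ffunP => -[].
apply: le_trans (dist_monotone_le _ _ mono_f) _.
by rewrite /disagreement big_pred0 // => x; rewrite eqxx.
Qed.

Section BiasedReduction.
Variables (R : realType) (n k : nat) (p : R) (phi : bits 'I_k -> bool).
Hypotheses (p01 : 0 < p < 1) (n_gt0 : (0 < n)%N) (phi_increasing : increasing phi).
Variable err : R.
Hypothesis phi_approx : `|bit_prob R phi - p| <= err.
Hypotheses (err_le : 4 * n%:R * err <= p) (err_le1B : 4 * n%:R * err <= 1 - p).

Definition sample (u : bits ('I_n * 'I_k)%type) : bits 'I_n := encode phi (curry_ffun u).

Lemma sample_le u v : bits_le u v -> bits_le (sample u) (sample v).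
Proof.
move=> uv i; rewrite !ffunE; apply: phi_increasing => j; rewrite !ffunE; exact: uv.
Qed.

Lemma approx_bit_prob_bounds : 0 < bit_prob R phi < 1.
Proof.
have n1 : 1 <= n%:R :> R by rewrite ler1n.
by move: phi_approx err_le err_le1B p01; rewrite ler_norml; nra.
Qed.

Lemma biased_le_code_law (x : cube n) : biased p x <= 2 * code_law R _ phi x.
Proof.
have [p0 p1] := andP p01; have pw : 0 <= p <= 1 by rewrite !ltW.
have n1 : 1 <= n%:R :> R by rewrite ler1n.
pose delta : R := (2 * n%:R)^-1.
have delta0 : 0 <= delta by rewrite invr_ge0; lra.
have err0 : 0 <= err by exact: le_trans (normr_ge0 _) phi_approx.
have ratio (a b : R) : 4 * n%:R * err <= a -> a - err <= b -> a <= (1 + delta) * b.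
  move=> a_ge b_ge; have delta1 : delta <= 1 by rewrite invf_le1; lra.
  have : 2 * err <= delta * a.
    have := ler_wpM2l delta0 a_ge; have : delta * n%:R = 2^-1.
      by rewrite /delta; field; rewrite gt_eqF //; lra.
    move=> dn; have -> : delta * (4 * n%:R * err) = 4 * (delta * n%:R) * err by ring.
    by rewrite dn; lra.
  by have := ler_wpM2l (_ : 0 <= 1 + delta) b_ge; nra.
have bit_le b : bernoulli pw b <= (1 + delta) * bernoulli (bit_prob_bounds R phi) b.
  move: phi_approx err_le err_le1B; rewrite ler_norml => /andP [approx_ge approx_le].
  by move=> le0 le1; case: b; apply: ratio; rewrite //=; lra.
rewrite (biasedE pw); apply: le_trans (ffun_mass_le x bit_le) _.
rewrite ler_wpM2r ?mass_ge0 // card_ord exprD1_le2 //.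
by rewrite /delta mulfV // gt_eqF //; lra.
Qed.

Lemma far_sample (eps : R) (f : boolfun n) : far_from_monotone (biased p) eps f ->
  far_from_increasing (eps / 4) (f \o sample).
Proof.
move=> far h h_increasing.
have pw : 0 <= p <= 1 by have [p0 p1] := andP p01; rewrite !ltW.
pose g (U : {ffun 'I_n -> bits 'I_k}) := h (uncurry_ffun U).
have -> : dist R (f \o sample) h
    = \E_(U ~ pmf_ffun 'I_n fair_bits) (f (encode phi U) != g U)%:R.
  rewrite /dist /fair_bits expect_curry; apply: eq_expect => U.
  by rewrite /= /sample uncurry_ffunK.
have g_increasing (U V : {ffun 'I_n -> bits 'I_k}) :
    (forall i, bits_le (U i) (V i)) -> g U -> g V.
  by move=> UV; apply: h_increasing => -[i j]; rewrite !ffunE; exact: UV.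
rewrite (_ : eps / 4 = eps / 2 / 2); last by field.
apply: (far_encode phi_increasing g_increasing) approx_bit_prob_bounds _ => g' g'_increasing.
have := le_trans far (dist_monotone_le _ _ (increasing_monotone g'_increasing)).
rewrite (disagreement_biased pw); under eq_expect do rewrite ffunE.
move=> /le_trans/(_ (expect_dominated (c := 2) (nu := code_law R _ phi) _ _)).
rewrite ler_pdivrMr // mulrC; apply => // x.
by rewrite -biasedE biased_le_code_law.
Qed.

End BiasedReduction.

(** * From pair tests to testers *)

Lemma all_zip_halves (T U : Type) (a b : T -> U) (f : U -> bool) (e : seq T) M :
  size e = M ->
  all (fun lh => lh.1 ==> lh.2)
    (zip (take M [seq f x | x <- map a e ++ map b e])
         (drop M [seq f x | x <- map a e ++ map b e]))
  = all (fun i => f (a i) ==> f (b i)) e.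
Proof.
move=> <-; rewrite map_cat take_size_cat ?size_map // drop_size_cat ?size_map //.
by rewrite -!map_comp zip_map all_map.
Qed.

Section Repetition.
Variables (R : realType) (n : nat) (T : pair_test R 'I_n) (M : nat).
Implicit Types f : boolfun n.

Let rounds : pmf R {ffun 'I_M -> pair_coins T} := pmf_ffun 'I_M (pair_law T).

Definition repeated_test : nonadaptive_algorithm R n :=
  @NonadaptiveAlgorithm R n _ rounds (mass_ge0 rounds) (mass_sum1 rounds)
    (fun s => [seq pair_low (s i) | i <- enum 'I_M] ++ [seq pair_high (s i) | i <- enum 'I_M])
    (fun _ answers => all (fun lh => lh.1 ==> lh.2) (zip (take M answers) (drop M answers))).

Lemma query_complexity_repeated : (query_complexity repeated_test <= 2 * M)%N.
Proof.
apply/bigmax_leqP => s _ /=.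
by rewrite size_cat !size_map -enumT size_enum_ord addnn mul2n.
Qed.

Lemma accepts_repeated f s :
  @accepts _ _ repeated_test f s = [forall i, ~~ catches f (s i)].
Proof.
have -> : @accepts _ _ repeated_test f s
    = all (fun i => f (pair_low (s i)) ==> f (pair_high (s i))) (enum 'I_M).
  by apply: all_zip_halves; rewrite size_enum_ord.
apply/allP/forallP => [ok i|ok i _].
  by rewrite negb_and negbK -implybE ok ?mem_enum.
by rewrite implybE -[f (pair_high _)]negbK -negb_and; exact: ok.
Qed.

Lemma prob_accept_repeated f : prob_accept repeated_test f = (1 - catch_prob T f) ^+ M.
Proof.
have -> : 1 - catch_prob T f = \sum_(c | ~~ catches f c) pair_law T c.
  rewrite -{1}(mass_sum1 (pair_law T)) /catch_prob /expect -sumrB [RHS]big_mkcond.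
  by apply: eq_bigr => c _; case: (catches f c); rewrite ?mulr1 ?mulr0 ?subrr ?subr0.
rewrite -[M in RHS]card_ord -prodr_const bigA_distr_big.
apply: eq_bigl => s; rewrite accepts_repeated.
by apply/forallP/ffun_onP.
Qed.

Lemma repeated_accepts_monotone f : monotone f -> prob_accept repeated_test f = 1.
Proof.
move=> /monotone_increasing incr; rewrite prob_accept_repeated.
suff -> : catch_prob T f = 0 by rewrite subr0 expr1n.
rewrite -[RHS](expect_const (pair_law T)); apply: eq_expect => c.
by rewrite /catches; case fc: (f _) => //=; rewrite (incr _ _ (@pair_le _ _ T c) fc).
Qed.

Lemma expr1B_le (r : R) : 0 <= r <= 1 -> (1 - r) ^+ M * (1 + M%:R * r) <= 1.
Proof.
move=> /andP [r0 r1]; elim: M => [|m IH]; first by rewrite expr0 mul0r addr0 mul1r.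
apply: le_trans IH; rewrite exprSr -mulrA; apply: ler_wpM2l.
  by rewrite exprn_ge0 // subr_ge0.
by rewrite -natr1; have : 0 <= m%:R :> R by []; nra.
Qed.

Lemma repeated_rejects (rho : R) f : 0 < rho -> 2 <= M%:R * rho ->
  rho <= catch_prob T f -> 2 / 3 <= prob_reject repeated_test f.
Proof.
move=> rho0 M_large rho_le.
have -> : prob_reject repeated_test f = 1 - prob_accept repeated_test f.
  rewrite -[1](mass_sum1 rounds) (bigID (fun s => @accepts _ _ repeated_test f s)) /=.
  by rewrite /prob_accept addrAC subrr add0r.
rewrite prob_accept_repeated; have r01 := catch_prob_bounds T f.
have := expr1B_le r01; move: rho_le r01; set r := catch_prob T f => rho_le /andP [_ r1].
have : 0 <= (1 - r) ^+ M by rewrite exprn_ge0 // subr_ge0.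
have : 2 <= M%:R * r by apply: le_trans M_large _; rewrite ler_wpM2l.
by move: (_ ^+ M) => x; nra.
Qed.

End Repetition.

Lemma tester_of_pair_test (R : realType) n (mu : cube n -> R) (eps rho : R)
    (T : pair_test R 'I_n) : 0 < rho <= 1 ->
  (forall f : boolfun n, far_from_monotone mu eps f -> rho <= catch_prob T f) ->
  exists2 A : nonadaptive_algorithm R n,
    (query_complexity A)%:R <= 6 / rho & monotonicity_tester mu eps A.
Proof.
move=> /andP [rho0 rho1] detect; pose M := (Num.truncn (2 / rho)).+1.
exists (repeated_test T M).
  apply: le_trans (_ : _ <= (2 * M)%:R) _; first by rewrite ler_nat query_complexity_repeated.
  have : M%:R <= 2 / rho + 1 by rewrite /M -natr1 lerD2r truncn_le divr_ge0 // ltW.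
  have : 1 <= rho^-1 by rewrite invf_ge1.
  by rewrite natrM; lra.
split=> f; first exact: repeated_accepts_monotone.
move=> /detect; apply: repeated_rejects => //.
by rewrite -ler_pdivrMr // ltW // truncnS_gt.
Qed.

Section NoQueries.
Variables (R : realType) (n : nat).

Lemma unit_mass_sum1 : \sum_(u : unit) 1 = 1 :> R.
Proof. by rewrite (big_pred1 tt) // => -[]. Qed.

Definition accept_all : nonadaptive_algorithm R n :=
  @NonadaptiveAlgorithm R n unit (fun=> 1) (fun=> ler01) unit_mass_sum1
    (fun=> [::]) (fun _ _ => true).

Lemma query_complexity_accept_all : query_complexity accept_all = 0%N.
Proof. by apply/eqP; rewrite -leqn0; apply/bigmax_leqP. Qed.

Lemma accept_all_tester (mu : cube n -> R) (eps : R) :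
  (forall f, ~ far_from_monotone mu eps f) -> monotonicity_tester mu eps accept_all.
Proof.
move=> not_far; split=> [f _|f /not_far //].
by rewrite /prob_accept /= (big_pred1 tt) // => -[].
Qed.

End NoQueries.

(** * The tester for the biased measure *)

Lemma half_pow_small (R : realType) (x : R) : 0 < x -> exists k, 4 * 2^-1 ^+ k <= x.
Proof.
move=> x0; pose k := (Num.truncn (4 / x)).+1; exists k.
have k_large : 4 / x < k%:R := truncnS_gt _.
have k_le : k%:R <= 2 ^+ k :> R by rewrite -natrX ler_nat ltnW // ltn_expl.
rewrite exprVn ler_pdivrMr ?exprn_gt0 //.
by move: k_large; rewrite ltr_pdivrMr //; nra.
Qed.

Lemma ln2_ge (R : realType) : 2^-1 <= ln 2 :> R.
Proof.
rewrite -ler_expR lnK ?posrE // -[leLHS]invrK -expRN.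
have := expR_ge1Dx (- 2^-1 : R) => half_le.
by rewrite -[leRHS]invrK lef_pV2 ?posrE ?invr_gt0 ?expR_gt0 //; lra.
Qed.

Section LogFactor.
Variables (R : realType) (n : nat) (eps : R).
Hypothesis eps_gt0 : 0 < eps.

Definition log_factor : R := ln (n%:R + 2) + ln (eps^-1 + 2).

Lemma log_factor_ge1 : 1 <= log_factor.
Proof.
have ln_ge (x : R) : 0 <= x -> 2^-1 <= ln (x + 2).
  by move=> x0; apply: le_trans (ln2_ge R) _; rewrite ler_ln ?posrE //; lra.
have := ln_ge n%:R (ler0n _ _); have := ln_ge eps^-1; rewrite invr_ge0 ltW // => /(_ isT).
by rewrite /log_factor; lra.
Qed.

Lemma exp_log_factor : exists2 m : nat, m%:R <= 2 * log_factor + 1 &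
  (n%:R + 2) * (eps^-1 + 2) <= 2 ^+ m.
Proof.
have L1 := log_factor_ge1; set m := (Num.truncn (2 * log_factor)).+1; exists m.
  by rewrite /m -natr1 lerD2r truncn_le; lra.
have eps_inv : 0 < eps^-1 by rewrite invr_gt0.
have n_ge0 : 0 <= n%:R :> R by [].
have <- : expR log_factor = (n%:R + 2) * (eps^-1 + 2).
  by rewrite /log_factor expRD !lnK ?posrE //; lra.
rewrite -[2]lnK ?posrE // -expRM_natl ler_expR.
have m_large : 2 * log_factor < m%:R := truncnS_gt _.
by have := ln2_ge R; nra.
Qed.

End LogFactor.

Lemma precision_exists (R : realType) (p : R) : 0 < p < 1 ->
  exists2 K : R, 0 <= K & forall n (eps : R), (0 < n)%N -> 0 < eps <= 1 -> exists m : nat,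
    [/\ 4 * n%:R * 2^-1 ^+ m <= p, 4 * n%:R * 2^-1 ^+ m <= 1 - p,
        n%:R / eps <= 2 ^+ m & m%:R <= K * log_factor n eps].
Proof.
move=> /andP [p0 p1].
have [k k_small] : exists k, 4 * 2^-1 ^+ k <= Num.min p (1 - p).
  by apply: half_pow_small; rewrite lt_min p0 subr_gt0.
exists (k%:R + 3) => [|n eps n_gt0 /andP [eps0 eps1]]; first by rewrite addr_ge0.
have [m m_le m_large] := exp_log_factor n eps0.
have n1 : 1 <= n%:R :> R by rewrite ler1n.
have ei : 1 <= eps^-1 by rewrite invf_ge1.
have n_le : n%:R / eps <= 2 ^+ m by apply: le_trans m_large; nra.
have small : 4 * n%:R * 2^-1 ^+ (k + m) <= Num.min p (1 - p).
  apply: le_trans k_small; rewrite exprD -mulrA ler_pM2l // mulrCA ler_piMr //.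
    by rewrite exprn_ge0 // invr_ge0.
  rewrite exprVn ler_pdivrMr ?exprn_gt0 // mul1r; apply: le_trans n_le.
  by rewrite ler_peMr //; lra.
exists (k + m)%N; split.
- by apply: le_trans small _; rewrite ge_min lexx.
- by apply: le_trans small _; rewrite ge_min lexx orbT.
- by apply: le_trans n_le _; rewrite ler_weXn2l ?ler1n // leq_addl.
- have := log_factor_ge1 n eps0; rewrite natrD; have : 0 <= k%:R :> R by [].
  by move: (k%:R) => x; nra.
Qed.

Definition pair_constant (R : realType) : R := 16 * 6 ^+ 6 * tester_constant R.

Lemma pair_constant_ge1 (R : realType) : 1 <= pair_constant R.
Proof.
apply: mulr_ege1 (tester_constant_ge1 R).
by apply: mulr_ege1; rewrite ?exprn_ege1 ?ler1n.
Qed.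

Section BiasedTester.
Variables (R : realType) (n m : nat) (p eps : R).
Hypotheses (p01 : 0 < p < 1) (n_gt0 : (0 < n)%N) (eps01 : 0 < eps <= 1).
Hypotheses (m_le : 4 * n%:R * 2^-1 ^+ m <= p) (m_le1B : 4 * n%:R * 2^-1 ^+ m <= 1 - p).
Hypothesis m_large : n%:R / eps <= 2 ^+ m.

Definition pair_rate : R :=
  eps ^+ 2 / (pair_constant R * m%:R ^+ 7 * Num.sqrt n%:R).

Lemma precision_gt0 : (0 < m)%N.
Proof.
rewrite lt0n; apply/eqP => m0; move: m_le m_le1B; rewrite m0 expr0 mulr1.
have : 1 <= n%:R :> R by rewrite ler1n.
by have := p01; lra.
Qed.

Let l := (2 * m + 4)%N.

Lemma exponent_large : 4 * (n * m)%:R / (eps / 4) <= 2 ^+ l.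
Proof.
have /andP [eps0 _] := eps01.
have -> : 4 * (n * m)%:R / (eps / 4) = m%:R * (n%:R / eps) * 2 ^+ 4.
  by rewrite natrM; field; rewrite gt_eqF.
have -> : 2 ^+ l = 2 ^+ m * 2 ^+ m * 2 ^+ 4 :> R by rewrite /l mul2n -addnn !exprD.
rewrite ler_pM2r ?exprn_gt0 //; apply: ler_pM => //; first by rewrite divr_ge0 // ltW.
by rewrite -natrX ler_nat ltnW // ltn_expl.
Qed.

Lemma pair_rate_le :
  pair_rate <= (eps / 4) ^+ 2 / (tester_constant R * l%:R ^+ 6 * Num.sqrt (n * m)%:R).
Proof.
have m0 : 0 < m%:R :> R by rewrite ltr0n precision_gt0.
have l0 : 0 < l%:R :> R by rewrite ltr0n /l addn4.
have sn0 : 0 < Num.sqrt n%:R :> R by rewrite sqrtr_gt0 ltr0n.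
have sm0 : 0 < Num.sqrt m%:R :> R by rewrite sqrtr_gt0.
have c0 := lt_le_trans ltr01 (tester_constant_ge1 R).
have l_le : l%:R <= 6 * m%:R :> R.
  by rewrite -natrM ler_nat /l (mulnDl 2 4) leq_add2l leq_pmulr // precision_gt0.
have lm_le : l%:R ^+ 6 * Num.sqrt m%:R <= 6 ^+ 6 * m%:R ^+ 6 * m%:R :> R.
  apply: ler_pM; rewrite ?exprn_ge0 ?sqrtr_ge0 ?sqrt_nat_le //.
  by rewrite -exprMn lerXn2r ?nnegrE ?mulr_ge0.
rewrite /pair_rate natrM sqrtrM // expr_div_n -[leRHS]mulrA -invfM ler_wpM2l ?sqr_ge0 //.
rewrite lef_pV2 ?posrE ?mulr_gt0 ?exprn_gt0 ?(lt_le_trans ltr01 (pair_constant_ge1 R)) //.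
have := ler_wpM2l (ltW (mulr_gt0 c0 sn0)) lm_le.
rewrite /pair_constant [m%:R ^+ 7]exprSr; move: (6 ^+ 6) (tester_constant R) => a b.
by lra.
Qed.

Lemma biased_pair_test : exists T : pair_test R 'I_n, forall f : boolfun n,
  far_from_monotone (biased p) eps f -> pair_rate <= catch_prob T f.
Proof.
have /andP [eps0 eps1] := eps01.
have pw : 0 <= p <= 1 by have /andP [p0 p1] := p01; rewrite !ltW.
have [phi phi_incr phi_approx] := increasing_bit_approx m pw.
have card_I : #|{: 'I_n * 'I_m}| = (n * m)%N by rewrite card_prod !card_ord.
have I_gt0 : (0 < #|{: 'I_n * 'I_m}|)%N by rewrite card_I muln_gt0 n_gt0 precision_gt0.
exists (pushforward_test (uniform_tester R l I_gt0) (sample_le phi_incr)) => f far.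
apply: le_trans pair_rate_le _; rewrite catch_prob_pushforward -card_I.
apply: catch_prob_uniform_tester.
- by rewrite divr_gt0 //= ler_pdivrMr // mul1r; lra.
- by rewrite card_I exponent_large.
- exact: (far_sample p01 n_gt0 phi_incr phi_approx m_le m_le1B).
Qed.

Lemma biased_pair_test_tester : exists2 A : nonadaptive_algorithm R n,
  (query_complexity A)%:R <= 6 / pair_rate & monotonicity_tester (biased p) eps A.
Proof.
have [T detect] := biased_pair_test; apply: tester_of_pair_test detect.
have /andP [eps0 eps1] := eps01.
have m1 : 1 <= m%:R ^+ 7 :> R by rewrite exprn_ege1 // ler1n precision_gt0.
have n1 : 1 <= Num.sqrt n%:R :> R by exact: sqrt_nat_ge1.
have denom1 : 1 <= pair_constant R * m%:R ^+ 7 * Num.sqrt n%:R.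
  by apply: mulr_ege1 n1; apply: mulr_ege1 m1; exact: pair_constant_ge1.
rewrite /pair_rate divr_gt0 ?exprn_gt0 ?(lt_le_trans ltr01 denom1) //=.
rewrite ler_pdivrMr ?(lt_le_trans ltr01 denom1) // mul1r.
by apply: le_trans denom1; rewrite exprn_ile1 // ltW.
Qed.

End BiasedTester.

Lemma biased_tester (R : realType) (p : R) : 0 < p < 1 ->
  exists C : R, forall n (eps : R), 0 < eps -> exists2 A : nonadaptive_algorithm R n,
    (query_complexity A)%:R <= C * (Num.sqrt n%:R / eps ^+ 2) * log_factor n eps ^+ 7 &
    monotonicity_tester (biased p) eps A.
Proof.
move=> p01; have pw : 0 <= p <= 1 by have /andP [p0 p1] := p01; rewrite !ltW.
have [K K0 precision] := precision_exists p01.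
pose c : R := 6 * pair_constant R.
have c0 : 0 <= c by rewrite mulr_ge0 // (le_trans ler01) // pair_constant_ge1.
exists (c * K ^+ 7) => n eps eps0.
have rate0 : 0 <= Num.sqrt n%:R / eps ^+ 2 by rewrite divr_ge0 ?sqrtr_ge0 ?sqr_ge0.
have [far_exists|no_far] := pselect (exists f : boolfun n, far_from_monotone (biased p) eps f);
    last first.
  exists (accept_all R n); last by apply: accept_all_tester => f far; case: no_far; exists f.
  have L0 := le_trans ler01 (log_factor_ge1 n eps0).
  rewrite query_complexity_accept_all; apply: mulr_ge0; last exact: exprn_ge0.
  exact: mulr_ge0 (mulr_ge0 c0 (exprn_ge0 _ K0)) rate0.
have [f far] := far_exists.
have eps1 : eps <= 1 := le_trans far (dist_monotone_biased_le1 pw f).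
have n_gt0 : (0 < n)%N.
  rewrite lt0n; apply/eqP => n0; move: f far; rewrite n0 => f.
  move=> /le_trans /(_ (dist_monotone_cube0 _ _)).
  by rewrite leNgt eps0.
have [|m [m_le m_le1B m_large m_log]] := precision n eps n_gt0; first by rewrite eps0.
have [|A queries tester] := biased_pair_test_tester p01 n_gt0 _ m_le m_le1B m_large.
  by rewrite eps0.
exists A => //; apply: le_trans queries _.
have -> : 6 / pair_rate n m eps = c * (Num.sqrt n%:R / eps ^+ 2) * m%:R ^+ 7.
  by rewrite /pair_rate invfM invrK /c; ring.
have -> : c * K ^+ 7 * (Num.sqrt n%:R / eps ^+ 2) * log_factor n eps ^+ 7
    = c * (Num.sqrt n%:R / eps ^+ 2) * (K * log_factor n eps) ^+ 7 by ring.
apply: ler_wpM2l; first exact: mulr_ge0.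
by rewrite lerXn2r ?nnegrE // (le_trans _ m_log).
Qed.

Theorem theorem1p1 (R : realType) (p : R) (hp0 : 0 < p) (hp1 : p < 1) :
  exists T : forall n : nat, R -> nonadaptive_algorithm R n,
    soft_O (fun n eps => (query_complexity (T n eps))%:R)
           (fun n eps => Num.sqrt n%:R / eps ^+ 2) /\
    forall (n : nat) (eps : R), 0 < eps ->
      monotonicity_tester (biased p) eps (T n eps).
Proof.
have [|C testers] := @biased_tester R p; first by rewrite hp0.
have tester n eps : {A : nonadaptive_algorithm R n | 0 < eps ->
    (query_complexity A)%:R <= C * (Num.sqrt n%:R / eps ^+ 2) * log_factor n eps ^+ 7 /\
    monotonicity_tester (biased p) eps A}.
  apply: cid; have [eps0|_] := ltP 0 eps; last by exists (accept_all R n).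
  by have [A queries tests] := testers n eps eps0; exists A.
exists (fun n eps => sval (tester n eps)); split=> [|n eps eps0].
  by exists C, 7%N => n eps /(svalP (tester n eps)) [].
by have [] := svalP (tester n eps) eps0.
Qed.
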